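(* Let $m,n\in\mathbb N$ and $f\in\mathbb Z^{m+n}_+$. Then in $\mathcal E^{m+n}$ $$\mathcal U_f=\sum_{\Sigma\subseteq\Sigma^+_f}q^{|\Sigma|}\mathcal K_{f_\Sigma},$$ the sum being over all subsets $\Sigma$ of $\Sigma^+_f$.
   Context: Quantum group: $\mathcal U$ is the $\mathbb Q(q)$-algebra $U_q(\mathfrak{sl}(\infty))$ generated by $E_a,F_a,K_{a,a+1}^{\pm1}$ ($a\in\mathbb Z$), a subalgebra of the standard $U_q(\mathfrak{gl}(\infty))$; comultiplication $\Delta(E_a)=1\otimes E_a+E_a\otimes K_{a+1,a}$, $\Delta(F_a)=F_a\otimes1+K_{a,a+1}\otimes F_a$, $\Delta(K_{a,a+1})=K_{a,a+1}\otimes K_{a,a+1}$, where $K_{a+1,a}=K_{a,a+1}^{-1}$; bar map on $\mathcal U$: ring automorphism with $\bar q=q^{-1}$ fixing $E_a,F_a$ and inverting $K_{a,a+1}$. For $k\in\mathbb N$, $\Lambda^k\mathbb V$ is the $\mathcal U$-module with basis $v_{a_1}\wedge\cdots\wedge v_{a_k}$ ($a_1>\cdots>a_k$ integers), where for index set $S$: $F_a$ replaces $a$ by $a+1$ if $a\in S,a+1\notin S$ (else $0$), $E_a$ replaces $a+1$ by $a$ if $a+1\in S,a\notin S$ (else $0$), $K_{a,a+1}$ acts by $q^{[a\in S]-[a+1\in S]}$. Fock space: $I(m|n)=\{-m,\dots,-1\}\cup\{1,\dots,n\}$, $\mathbb Z^{m+n}$ the functions $I(m|n)\to\mathbb Z$,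 $\mathbb Z^{m+n}_+=\{f:f(-m)>\cdots>f(-1),\ f(1)>\cdots>f(n)\}$. $\mathcal E^{m+n}=\Lambda^m\mathbb V\otimes\Lambda^n\mathbb V$ (a $\mathcal U$-module via $\Delta$) with monomial basis $\mathcal K_f=v_{f(-m)}\wedge\cdots\wedge v_{f(-1)}\otimes v_{f(1)}\wedge\cdots\wedge v_{f(n)}$, $f\in\mathbb Z^{m+n}_+$. Bruhat ordering on $\mathbb Z^{m+n}$: transitive closure of $f<f\cdot\tau_{ij}$ for $i<j$ in $I(m|n)$ with $f(i)<f(j)$ ($\tau_{ij}$ transposition, $(f\cdot\tau)(k)=f(\tau(k))$); $f\in\mathbb Z^{m+n}_+$ is J-typical if minimal in $\mathbb Z^{m+n}_+$. The bar involution is the unique anti-linear map $u\mapsto\bar u$ on $\mathcal E^{m+n}$ with $\overline{\mathcal K_f}=\mathcal K_f$ for J-typical $f$, $\overline{Xu}=\bar X\bar u$ for $X\in\mathcal U$, which is an involution and satisfies $\overline{\mathcal K_f}\in\mathcal K_f+\sum_{g<f}\mathbb Z[q,q^{-1}]\mathcal K_g$. The canonical basis element $\mathcal U_f$ is the unique bar-invariant element in $\mathcal K_f+\sum_{g<f}q\mathbb Z[q]\mathcal K_g$. Positive pairs: for $f\in\mathbb Z^{m+n}$ injective on $\{-m,\dots,-1\}$ and on $\{1,\dots,n\}$, a pair $(i|j)$, $-m\le i\le-1$, $1\le j\le n$, is atypical if $f(i)>f(j)$, $f(i)\ne f(k)$ for all $1\le k\le n$, and $f(l)\ne f(j)$ for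 all $-m\le l\le-1$; its distance is $f(i)-f(j)$. Pairs are disjoint if they share neither entry. Recursively, $\Sigma^k_f$ ($k\ge1$) is the set of atypical pairs of distance $k$ disjoint from every pair in $\Sigma^1_f\cup\cdots\cup\Sigma^{k-1}_f$, and $\Sigma^+_f=\bigcup_{k\ge1}\Sigma^k_f$. For $\Sigma=\{(i_1|j_1),\dots,(i_k|j_k)\}\subseteq\Sigma^+_f$, $f_\Sigma\in\mathbb Z^{m+n}_+$ is obtained by exchanging the values $f(i_s)$ and $f(j_s)$ for all $s$ and then rearranging the values at negative positions in decreasing order and the values at positive positions in decreasing order. *)

(* Defs.v *)
From HB Require Import structures.
From mathcomp Require Import all_boot all_order all_algebra all_fingroup.
From mathcomp Require Import fraction generic_quotient.
From Stdlib Require Import Relations.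

Set Implicit Arguments.
Unset Strict Implicit.
Unset Printing Implicit Defensive.

Import Order.TTheory GRing.Theory Num.Theory.
Local Open Scope ring_scope.

Definition Qq : Type := {fraction {poly rat}}.

Definition qq : Qq := FracField.tofrac ('X : {poly rat}).

Definition ev_qinv (p : {poly rat}) : Qq :=
  (map_poly (fun c : rat => FracField.tofrac (c%:P)) p).[qq^-1].

Definition barQ (x : Qq) : Qq :=
  let r := repr x in ev_qinv \n_r / ev_qinv \d_r.

Definition in_ZLaurent (x : Qq) : Prop :=
  exists (p : {poly int}) (k : nat),
    x = FracField.tofrac (map_poly (fun z : int => z%:~R : rat) p) / qq ^+ k.

Definition in_qZq (x : Qq) : Prop :=
  exists p : {poly int},
    x = qq * FracField.tofrac (map_poly (fun z : int => z%:~R : rat) p).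

(* Functions I(m|n) -> Z.  The index set I(m|n) = {-m<...<-1<1<...<n}  *)
(* is encoded by 'I_(m+n): position k < m stands for -m+k ("negative"), *)
(* position k >= m stands for k-m+1 ("positive"); the order is kept.    *)

Definition Zmn (m n : nat) : Type := {ffun 'I_(m + n) -> int}.

Definition negpos m n (i : 'I_(m + n)) : bool := (i < m)%N.
Arguments negpos m {n} i.

Definition dominant m n (f : Zmn m n) : Prop :=
  forall i j : 'I_(m + n), (i < j)%N ->
    (negpos m j || ~~ negpos m i) -> f j < f i.

Definition bruhat_step m n (f g : Zmn m n) : Prop :=
  exists i j : 'I_(m + n), (i < j)%N /\ f i < f j /\
    g = [ffun k => f (tperm i j k)].

Definition bruhat_lt m n : relation (Zmn m n) := clos_trans _ (@bruhat_step m n).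

Definition J_typical m n (f : Zmn m n) : Prop :=
  dominant f /\ forall g : Zmn m n, dominant g -> ~ bruhat_lt g f.

(* The Fock space E^{m+n} = Lambda^m V (x) Lambda^n V.                 *)
(* A vector is its coefficient function on the monomial basis K_f,     *)
(* f in Z^{m+n}_+; genuine vectors have finite support in Z^{m+n}_+.   *)

Definition Fock m n : Type := Zmn m n -> Qq.

Definition inE m n (u : Fock m n) : Prop :=
  (exists s : seq (Zmn m n), forall g, u g != 0 -> g \in s) /\
  (forall g, u g != 0 -> dominant g).

Definition Kmon m n (f : Zmn m n) : Fock m n :=
  fun g => if g == f then 1 else 0.

Definition addF m n (u v : Fock m n) : Fock m n := fun g => u g + v g.
Definition scaleF m n (c : Qq) (u : Fock m n) : Fock m n := fun g => c * u g.

Definition inL m n (f : Zmn m n) (a : int) : bool :=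
  [exists i : 'I_(m + n), negpos m i && (f i == a)].
Definition inR m n (f : Zmn m n) (a : int) : bool :=
  [exists i : 'I_(m + n), ~~ negpos m i && (f i == a)].

Definition shL m n (f : Zmn m n) (a b : int) : Zmn m n :=
  [ffun k => if negpos m k && (f k == a) then b else f k].
Definition shR m n (f : Zmn m n) (a b : int) : Zmn m n :=
  [ffun k => if ~~ negpos m k && (f k == a) then b else f k].

Definition b2z (b : bool) : int := (nat_of_bool b)%:Z.

(* Action of the generators via the comultiplication
     Delta(F_a) = F_a (x) 1 + K_{a,a+1} (x) F_a,
     Delta(E_a) = 1 (x) E_a + E_a (x) K_{a+1,a},
     Delta(K_{a,a+1}) = K_{a,a+1} (x) K_{a,a+1}.
   Written coefficientwise: (X u)(g) = sum_h [coeff of K_g in X K_h] u(h),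
   where only the (at most two) possible h are listed. *)
Definition actF m n (a : int) (u : Fock m n) : Fock m n := fun g =>
  (if inL g (a + 1) && ~~ inL g a then u (shL g (a + 1) a) else 0) +
  (if inR g (a + 1) && ~~ inR g a then
     qq ^ (b2z (inL g a) - b2z (inL g (a + 1))) * u (shR g (a + 1) a)
   else 0).

Definition actE m n (a : int) (u : Fock m n) : Fock m n := fun g =>
  (if inR g a && ~~ inR g (a + 1) then u (shR g a (a + 1)) else 0) +
  (if inL g a && ~~ inL g (a + 1) then
     qq ^ (b2z (inR g (a + 1)) - b2z (inR g a)) * u (shL g a (a + 1))
   else 0).

Definition actK m n (a : int) (u : Fock m n) : Fock m n := fun g =>
  qq ^ (b2z (inL g a) - b2z (inL g (a + 1)) + b2z (inR g a) - b2z (inR g (a + 1)))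
  * u g.

Definition actKinv m n (a : int) (u : Fock m n) : Fock m n := fun g =>
  qq ^ (- (b2z (inL g a) - b2z (inL g (a + 1)) + b2z (inR g a) - b2z (inR g (a + 1))))
  * u g.

(* The bar involution on E^{m+n}: the defining properties.             *)
(* Compatibility with all X in U follows from compatibility with the   *)
(* generators E_a, F_a, K_{a,a+1}^{+-1} together with anti-linearity.  *)

Definition is_bar_involution m n (psi : Fock m n -> Fock m n) : Prop :=
  (forall u, inE u -> inE (psi u)) /\
  (forall u v, inE u -> inE v -> psi (addF u v) = addF (psi u) (psi v)) /\
  (forall c u, inE u -> psi (scaleF c u) = scaleF (barQ c) (psi u)) /\
  (forall f, J_typical f -> psi (Kmon f) = Kmon f) /\
  (forall a u, inE u -> psi (actE a u) = actE a (psi u)) /\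
  (forall a u, inE u -> psi (actF a u) = actF a (psi u)) /\
  (forall a u, inE u -> psi (actK a u) = actKinv a (psi u)) /\
  (forall a u, inE u -> psi (actKinv a u) = actK a (psi u)) /\
  (forall u, inE u -> psi (psi u) = u) /\
  (forall f, dominant f ->
     psi (Kmon f) f = 1 /\
     forall g, g != f -> psi (Kmon f) g != 0 ->
       bruhat_lt g f /\ in_ZLaurent (psi (Kmon f) g)).

Definition is_canonical m n (psi : Fock m n -> Fock m n) (f : Zmn m n)
    (u : Fock m n) : Prop :=
  inE u /\ psi u = u /\ u f = 1 /\
  forall g, g != f -> u g != 0 -> bruhat_lt g f /\ in_qZq (u g).

Definition ppair m n : finType := ('I_(m + n) * 'I_(m + n))%type.

Definition atypical m n (f : Zmn m n) (p : ppair m n) : bool :=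
  [&& negpos m p.1, ~~ negpos m p.2, f p.2 < f p.1,
      ~~ inR f (f p.1) & ~~ inL f (f p.2)].

Definition pdist m n (f : Zmn m n) (p : ppair m n) : nat := `|f p.1 - f p.2|%N.

Definition pdisjoint m n (p p' : ppair m n) : bool :=
  (p.1 != p'.1) && (p.2 != p'.2).

Fixpoint sig_upto m n (f : Zmn m n) (k : nat) : {set ppair m n} :=
  if k is k'.+1 then
    let P := sig_upto f k' in
    P :|: [set p | [&& atypical f p, pdist f p == k'.+1 &
                       [forall p', (p' \in P) ==> pdisjoint p p']]]
  else set0.

Definition sig_level m n (f : Zmn m n) (k : nat) : {set ppair m n} :=
  [set p | [&& atypical f p, pdist f p == k &
              [forall p', (p' \in sig_upto f k.-1) ==> pdisjoint p p']]].

(* Sigma^+_f = union over k >= 1 of Sigma^k_f; since every pair of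
   Sigma^k_f has distance k, p is in the union iff p is in Sigma^(dist p). *)
Definition SigmaPlus m n (f : Zmn m n) : {set ppair m n} :=
  [set p | (0 < pdist f p)%N && (p \in sig_level f (pdist f p))].

Definition swapvals m n (f : Zmn m n) (S : {set ppair m n}) : Zmn m n :=
  [ffun k => if [pick p in S | p.1 == k] is Some p then f p.2
             else if [pick p in S | p.2 == k] is Some p then f p.1
             else f k].

Definition fSigma m n (f : Zmn m n) (S : {set ppair m n}) : Zmn m n :=
  let h := swapvals f S in
  let negv := sort (fun x y : int => y <= x)
                [seq h k | k <- enum 'I_(m + n) & negpos m k] in
  let posv := sort (fun x y : int => y <= x)
                [seq h k | k <- enum 'I_(m + n) & ~~ negpos m k] in
  [ffun k : 'I_(m + n) => if negpos m k then nth 0 negv k else nth 0 posv (k - m)].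

Definition rhs m n (f : Zmn m n) : Fock m n := fun g =>
  \sum_(S : {set ppair m n} | S \subset SigmaPlus f) qq ^+ #|S| * Kmon (fSigma f S) g.

(* Main.v *)
(* Record a dominant f by the sets L and R of its values at the negative and at
   the positive positions.  The pairs of SigmaPlus f are the cups of the
   parenthesis matching in which the elements of R \ L open and those of L \ R
   close, and the right-hand side becomes an iterated sum: each cup (a, b), with
   b < a, contributes the identity plus q times the exchange of a and b.  It is
   bar invariant because it is obtained from a J-typical monomial by the
   operators E_a and F_a, each of which creates a cup of length one or lengthens
   an innermost cup by one.  Triangularity holds because every exchange lowers
   the Bruhat ordering, and it forces uniqueness. *)
Require Import Defs.
From HB Require Import structures.
From mathcomp Require Import all_boot all_order all_algebra all_fingroup.
From mathcomp Require Import fraction generic_quotient.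
From mathcomp Require Import boolp zify ring.
From Stdlib Require Import Relation_Operators.

Set Implicit Arguments.
Unset Strict Implicit.
Unset Printing Implicit Defensive.

Import Order.TTheory GRing.Theory Num.Theory.
Local Open Scope ring_scope.

(** * The action of E_a and F_a on monomials *)

(** Call an integer full if it lies in both L and R, and empty if it lies in neither. The q of a cup
    (b + 1, b) comes from the comultiplication: when F_b moves the right-hand entry b, the factor
    K_{b,b+1} meets a left-hand side that contains b but not b + 1. Innermost cups are treated
    because every integer strictly inside one is full or empty. When the endpoint b crosses such a
    neighbour, exactly one tensor factor can move in each of the two terms of the cup, with exponent
    0, so no further terms or powers of q arise. Undoing a cup leaves one full and one empty
    integer, so that an enclosing cup becomes innermost in turn. Value sets are arbitrary predicates
    on the integers, and a pair (L, R) that is not realized by a dominant function stands for the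
    zero vector. The formulas for the operators are then local, and cardinalities never enter. *)

Definition move_val (A : pred int) (a b : int) : pred int :=
  fun x => (x != a) && ((x == b) || A x).

Lemma move_valK (A : pred int) (a b : int) : A a -> ~~ A b ->
  move_val (move_val A a b) b a = A.
Proof.
move=> Aa Ab; apply/funext => x; rewrite /move_val.
have [->|xb] /= := eqVneq x b; first by rewrite (negbTE Ab).
by have [->|xa] /= := eqVneq x a; rewrite ?Aa.
Qed.

Lemma move_valC (A : pred int) (a b c d : int) : a != d -> b != c ->
  move_val (move_val A a b) c d = move_val (move_val A c d) a b.
Proof.
move=> ad bc; apply/funext => x; rewrite /move_val.
have [->|xa] /= := eqVneq x a; first by rewrite (negbTE ad) andbF.
have [->|xc] /= := eqVneq x c; first by rewrite eq_sym (negbTE bc).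
by rewrite orbCA.
Qed.

Lemma move_val_trans_empty (A : pred int) (a b c : int) : ~~ A b -> c != a -> b != c ->
  move_val (move_val A a b) b c = move_val A a c.
Proof.
move=> Ab ca bc; apply/funext => x; rewrite /move_val.
have [->|xb] /= := eqVneq x b; last first.
  by have [->|] := eqVneq x c; rewrite ?ca //= orbF.
by rewrite (negbTE bc) (negbTE Ab) andbF.
Qed.

Lemma move_val_trans_full (A : pred int) (a b c : int) : A b -> b != a -> b != c ->
  move_val (move_val A b c) a b = move_val A a c.
Proof.
move=> Ab ba bc; apply/funext => x; rewrite /move_val.
have [->|xa] /= := eqVneq x b; last by [].
by rewrite (negbTE bc) Ab.
Qed.

Lemma move_val_out (A : pred int) (a b x : int) : x != a -> x != b ->
  move_val A a b x = A x.
Proof. by rewrite /move_val => -> /negbTE ->. Qed.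

(** This is the monomial with value sets [L] and [R], or the zero vector if no dominant function has
    them. The convention makes the action formulas valid for all predicates. *)
Definition weight_vector m n (L R : pred int) : Fock m n :=
  fun g => (`[< dominant g /\ inL g = L /\ inR g = R >] : nat)%:R.

Arguments weight_vector m n L R : clear implicits.

Section Action.
Variables m n : nat.
Implicit Types (g h : Zmn m n) (L R : pred int) (a b : int).

Lemma inLP g x : reflect (exists2 i, negpos m i & g i = x) (inL g x).
Proof.
by apply: (iffP existsP) => [[i /andP[? /eqP]]|[i ? <-]]; exists i => //; apply/andP.
Qed.

Lemma inRP g x : reflect (exists2 i, ~~ negpos m i & g i = x) (inR g x).
Proof.
by apply: (iffP existsP) => [[i /andP[? /eqP]]|[i ? <-]]; exists i => //; apply/andP.
Qed.

Lemma inL_shL g a b : inL g a -> ~~ inL g b -> inL (shL g a b) = move_val (inL g) a b.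
Proof.
move=> ga gb.
have ab : b != a by apply: contraNneq gb => ->.
apply/funext => x; rewrite /move_val.
apply/inLP/idP => [[i i1]|].
  rewrite ffunE i1 /=; case: eqP => [_ <-|/eqP gia <-]; first by rewrite ab eqxx.
  by rewrite gia; apply/orP; right; apply/inLP; exists i.
case/andP => xa /orP[/eqP ->|/inLP[i i1 gi]].
  by have/inLP[i i1 gi] := ga; exists i => //; rewrite ffunE i1 gi eqxx.
by exists i => //; rewrite ffunE i1 gi (negbTE xa).
Qed.

Lemma inR_shL g a b : inR (shL g a b) = inR g.
Proof.
apply/funext => x; apply/inRP/inRP => -[i i1]; rewrite ?ffunE ?(negbTE i1) => gi;
  by exists i; rewrite ?ffunE ?(negbTE i1).
Qed.

Lemma inR_shR g a b : inR g a -> ~~ inR g b -> inR (shR g a b) = move_val (inR g) a b.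
Proof.
move=> ga gb.
have ab : b != a by apply: contraNneq gb => ->.
apply/funext => x; rewrite /move_val.
apply/inRP/idP => [[i i1]|].
  rewrite ffunE i1 /=; case: eqP => [_ <-|/eqP gia <-]; first by rewrite ab eqxx.
  by rewrite gia; apply/orP; right; apply/inRP; exists i.
case/andP => xa /orP[/eqP ->|/inRP[i i1 gi]].
  by have/inRP[i i1 gi] := ga; exists i => //; rewrite ffunE i1 gi eqxx.
by exists i => //; rewrite ffunE i1 gi (negbTE xa).
Qed.

Lemma inL_shR g a b : inL (shR g a b) = inL g.
Proof.
apply/funext => x; apply/inLP/inLP => -[i i1]; rewrite ?ffunE ?i1 => gi;
  by exists i; rewrite ?ffunE ?i1.
Qed.

Lemma shLK g a b : ~~ inL g b -> shL (shL g a b) b a = g.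
Proof.
move=> gb; apply/ffunP => i; rewrite !ffunE.
case i1: (negpos m i) => //=; have [->|] := eqVneq (g i) a; first by rewrite eqxx.
by move=> _; case: eqVneq => // gi; case/negP: gb; apply/inLP; exists i.
Qed.

Lemma shRK g a b : ~~ inR g b -> shR (shR g a b) b a = g.
Proof.
move=> gb; apply/ffunP => i; rewrite !ffunE.
case i1: (negpos m i) => //=; have [->|] := eqVneq (g i) a; first by rewrite eqxx.
by move=> _; case: eqVneq => // gi; case/negP: gb; apply/inRP; exists i; rewrite ?i1.
Qed.

(** A move by one into a vacant value cannot pass another entry of the block. *)
Lemma dominant_shL g a b : `|a - b|%N = 1%N -> ~~ inL g b -> dominant g ->
  dominant (shL g a b).
Proof.
move=> ab gb dg i j ij blk; have := dg i j ij blk.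
have nb k : negpos m k -> g k != b.
  by move=> k1; apply: contraNneq gb => <-; apply/inLP; exists k.
have := nb i; have := nb j; rewrite !ffunE; move: blk.
case i1: (negpos m i); case j1: (negpos m j) => //= _.
by move=> /(_ isT) ? /(_ isT) ? ?; case: (eqVneq (g i) a) => ?; case: (eqVneq (g j) a) => ?; lia.
by move: i1 j1 ij; rewrite /negpos; lia.
Qed.

Lemma dominant_shR g a b : `|a - b|%N = 1%N -> ~~ inR g b -> dominant g ->
  dominant (shR g a b).
Proof.
move=> ab gb dg i j ij blk; have := dg i j ij blk.
have nb k : ~~ negpos m k -> g k != b.
  by move=> k1; apply: contraNneq gb => <-; apply/inRP; exists k.
have := nb i; have := nb j; rewrite !ffunE; move: blk.
case i1: (negpos m i); case j1: (negpos m j) => //=.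
  by move: i1 j1 ij; rewrite /negpos; lia.
by move=> _ /(_ isT) ? /(_ isT) ? ?; case: (eqVneq (g i) a) => ?; case: (eqVneq (g j) a) => ?; lia.
Qed.

(** The action takes the coefficient at [g] from the source of the move, that is, from [g] moved
    back. The lemma passes to the value sets of the target; the two moves are mutually inverse
    because one of the two values is occupied and the other vacant. *)
Lemma weight_vector_shL L R a b g : `|a - b|%N = 1%N -> inL g b -> ~~ inL g a ->
  weight_vector m n L R (shL g b a) =
  (L a && ~~ L b)%:R * weight_vector m n (move_val L a b) R g.
Proof.
move=> ab gb ga; have ab' : a != b by lia.
rewrite /weight_vector -natrM mulnb; congr (_%:R); congr (nat_of_bool _).
apply/asboolP/andP => [[dg [<- <-]]|[/andP[La Lb] /asboolP[dg [gL gR]]]].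
  rewrite inL_shL // inR_shL move_valK //; split.
    by rewrite /move_val !eqxx ab'.
  apply/asboolP; split=> //; rewrite -(shLK b ga); apply: dominant_shL => //.
  by rewrite inL_shL // /move_val eqxx.
by rewrite inL_shL // inR_shL gL move_valK //; split=> //; apply: dominant_shL => //; lia.
Qed.

Lemma weight_vector_shR L R a b g : `|a - b|%N = 1%N -> inR g b -> ~~ inR g a ->
  weight_vector m n L R (shR g b a) =
  (R a && ~~ R b)%:R * weight_vector m n L (move_val R a b) g.
Proof.
move=> ab gb ga; have ab' : a != b by lia.
rewrite /weight_vector -natrM mulnb; congr (_%:R); congr (nat_of_bool _).
apply/asboolP/andP => [[dg [<- <-]]|[/andP[La Lb] /asboolP[dg [gL gR]]]].
  rewrite inR_shR // inL_shR move_valK //; split.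
    by rewrite /move_val !eqxx ab'.
  apply/asboolP; split=> //; rewrite -(shRK b ga); apply: dominant_shR => //.
  by rewrite inR_shR // /move_val eqxx.
by rewrite inR_shR // inL_shR gR move_valK //; split=> //; apply: dominant_shR => //; lia.
Qed.

Lemma weight_vector_neq0 L R g : weight_vector m n L R g != 0 ->
  [/\ dominant g, inL g = L & inR g = R].
Proof.
rewrite /weight_vector; case: asboolP => [[? [? ?]] _|_]; first by [].
by rewrite eqxx.
Qed.

(** If the guard on [g] fails, then [g] cannot have a validly moved value set, so the right-hand
    side vanishes too. *)
Lemma shL_coef L R a b g : `|a - b|%N = 1%N ->
  (if inL g b && ~~ inL g a then weight_vector m n L R (shL g b a) else 0) =
  (L a && ~~ L b)%:R * weight_vector m n (move_val L a b) R g.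
Proof.
move=> ab; case: ifP => [/andP[gb ga]|gab]; first exact: weight_vector_shL.
case: (boolP (L a && ~~ L b)) => [/andP[La Lb]|]; last by rewrite mul0r.
rewrite mul1r; apply/esym/eqP/contraT => /weight_vector_neq0[_ gL _].
by move: gab; rewrite gL /move_val !eqxx /= andbT => /eqP; lia.
Qed.

Lemma shR_coef L R a b g : `|a - b|%N = 1%N ->
  (if inR g b && ~~ inR g a then weight_vector m n L R (shR g b a) else 0) =
  (R a && ~~ R b)%:R * weight_vector m n L (move_val R a b) g.
Proof.
move=> ab; case: ifP => [/andP[gb ga]|gab]; first exact: weight_vector_shR.
case: (boolP (R a && ~~ R b)) => [/andP[Ra Rb]|]; last by rewrite mul0r.
rewrite mul1r; apply/esym/eqP/contraT => /weight_vector_neq0[_ _ gR].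
by move: gab; rewrite gR /move_val !eqxx /= andbT => /eqP; lia.
Qed.

Lemma actF_weight_vector a L R g :
  actF a (weight_vector m n L R) g =
  (L a && ~~ L (a + 1))%:R * weight_vector m n (move_val L a (a + 1)) R g +
  (R a && ~~ R (a + 1))%:R * qq ^ (b2z (L a) - b2z (L (a + 1))) *
    weight_vector m n L (move_val R a (a + 1)) g.
Proof.
have a1 : `|a - (a + 1)%R|%N = 1%N by lia.
rewrite /actF shL_coef //; congr (_ + _).
rewrite -mulrA mulrCA -shR_coef //.
case: ifP => [/andP[gb ga]|_]; last by rewrite mulr0.
(* The exponent is read from [g] on one side and from [L] on the other; they agree wherever the
   coefficient is nonzero. *)
rewrite weight_vector_shR //; have [->|] := eqVneq (weight_vector m n L (move_val R a (a + 1)) g) 0.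
  by rewrite !mulr0.
by move/weight_vector_neq0=> [_ -> _].
Qed.

Lemma actE_weight_vector a L R g :
  actE a (weight_vector m n L R) g =
  (R (a + 1) && ~~ R a)%:R * weight_vector m n L (move_val R (a + 1) a) g +
  (L (a + 1) && ~~ L a)%:R * qq ^ (b2z (R (a + 1)) - b2z (R a)) *
    weight_vector m n (move_val L (a + 1) a) R g.
Proof.
have a1 : `|(a + 1)%R - a|%N = 1%N by lia.
rewrite /actE shR_coef //; congr (_ + _).
rewrite -mulrA mulrCA -shL_coef //.
case: ifP => [/andP[gb ga]|_]; last by rewrite mulr0.
rewrite weight_vector_shL //; have [->|] := eqVneq (weight_vector m n (move_val L (a + 1) a) R g) 0.
  by rewrite !mulr0.
by move/weight_vector_neq0=> [_ _ ->].
Qed.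

End Action.

(** * The Bruhat ordering *)

Definition only (A B : pred int) : pred int := fun x => A x && ~~ B x.

Lemma move_val_to (A : pred int) (a b : int) : b != a -> move_val A a b b.
Proof. by rewrite /move_val eqxx andbT. Qed.

Lemma move_val_from (A : pred int) (a b : int) : move_val A a b a = false.
Proof. by rewrite /move_val eqxx. Qed.

Section Bruhat.
Variables m n : nat.
Implicit Types (f g h : Zmn m n) (x t a b : int).

Definition Lseq h := [seq h k | k <- enum 'I_(m + n) & negpos m k].
Definition Rseq h := [seq h k | k <- enum 'I_(m + n) & ~~ negpos m k].

Lemma mem_Lseq h x : (x \in Lseq h) = inL h x.
Proof.
apply/mapP/inLP => [[k]|[k k1 <-]].
  by rewrite mem_filter => /andP[k1 _] ->; exists k.
by exists k; rewrite // mem_filter k1 mem_enum.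
Qed.

Lemma mem_Rseq h x : (x \in Rseq h) = inR h x.
Proof.
apply/mapP/inRP => [[k]|[k k1 <-]].
  by rewrite mem_filter => /andP[k1 _] ->; exists k.
by exists k; rewrite // mem_filter k1 mem_enum.
Qed.

Lemma sorted_enum_ord N : sorted (fun i j : 'I_N => (i < j)%N) (enum 'I_N).
Proof. by have := iota_ltn_sorted 0 N; rewrite -val_enum_ord sorted_map. Qed.

Lemma sorted_values (P : pred 'I_(m + n)) h :
  (forall i j : 'I_(m + n), P i -> P j -> (i < j)%N -> h j < h i) ->
  sorted (fun x y : int => y < x) [seq h k | k <- enum 'I_(m + n) & P k].
Proof.
move=> hP; rewrite sorted_map.
apply: (@sub_in_sorted _ P (fun i j : 'I_(m + n) => (i < j)%N)).
- by move=> i j Pi Pj; apply: hP.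
- exact: filter_all.
- by apply: sorted_filter (sorted_enum_ord _) => j i k; apply: ltn_trans.
Qed.

Lemma sorted_Lseq f : dominant f -> sorted (fun x y : int => y < x) (Lseq f).
Proof.
move=> df; apply: (@sorted_values (fun k => negpos m k)) => i j i1 j1 ij.
by apply: df; rewrite ?j1.
Qed.

Lemma sorted_Rseq f : dominant f -> sorted (fun x y : int => y < x) (Rseq f).
Proof.
move=> df; apply: (@sorted_values (fun k => ~~ negpos m k)) => i j i1 j1 ij.
by apply: df; rewrite ?i1 ?orbT.
Qed.

Lemma gt_trans_int : transitive (fun x y : int => y < x).
Proof. by move=> y x z yx zy; apply: lt_trans zy yx. Qed.

Lemma gt_irr_int : irreflexive (fun x y : int => y < x).
Proof. by move=> x; rewrite /= ltxx. Qed.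

Lemma uniq_Lseq f : dominant f -> uniq (Lseq f).
Proof. by move/sorted_Lseq; apply: sorted_uniq gt_trans_int gt_irr_int _. Qed.

Lemma uniq_Rseq f : dominant f -> uniq (Rseq f).
Proof. by move/sorted_Rseq; apply: sorted_uniq gt_trans_int gt_irr_int _. Qed.

Lemma dominant_inj f g : dominant f -> dominant g ->
  inL f = inL g -> inR f = inR g -> f = g.
Proof.
move=> df dg fgL fgR.
have /eq_in_map eL : Lseq f = Lseq g.
  apply: (irr_sorted_eq gt_trans_int gt_irr_int); try exact: sorted_Lseq.
  by move=> x; rewrite !mem_Lseq fgL.
have /eq_in_map eR : Rseq f = Rseq g.
  apply: (irr_sorted_eq gt_trans_int gt_irr_int); try exact: sorted_Rseq.
  by move=> x; rewrite !mem_Rseq fgR.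
apply/ffunP => k; case k1: (negpos m k); [apply: eL|apply: eR];
  by rewrite mem_filter k1 mem_enum.
Qed.

(** The rearrangement identity behind both monotone quantities of the Bruhat ordering: [w] is the
    position for [energy], and the indicator of the negative block for the counts of large
    values. *)
Lemma sum_tperm N (w c : 'I_N -> int) (i j : 'I_N) : i != j ->
  \sum_k w k * c (tperm i j k) = \sum_k w k * c k + (w i - w j) * (c j - c i).
Proof.
move=> ij; rewrite (bigD1 i) // [in RHS](bigD1 i) //=.
rewrite (bigD1 j) 1?eq_sym // [in RHS](bigD1 j) 1?eq_sym //= tpermL tpermR.
rewrite (eq_bigr (fun k => w k * c k)); first by ring.
by move=> k /andP[ki kj]; rewrite tpermD // eq_sym.
Qed.

(** A strictly decreasing function for the Bruhat ordering. It gives irreflexivity, drives the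
    sorting argument, and selects Bruhat-maximal elements of finite sets. *)
Definition energy h : int := \sum_(k < m + n) k%:Z * h k.

Lemma energy_step f g : bruhat_step f g -> energy g < energy f.
Proof.
move=> [i [j [ij [fij ->]]]]; rewrite /energy.
under eq_bigr => k _ do rewrite ffunE.
rewrite (sum_tperm (fun k => k%:Z)); last by apply/eqP => eij; rewrite eij ltnn in ij.
by rewrite gtrDl nmulr_rlt0; lia.
Qed.

Lemma energy_lt f g : bruhat_lt g f -> energy f < energy g.
Proof.
elim=> [x y /energy_step //|x y z _ xy _ yz].
exact: lt_trans yz xy.
Qed.

Lemma bruhat_irr f : ~ bruhat_lt f f.
Proof. by move/energy_lt; rewrite ltxx. Qed.

Lemma count_Lseq h t : ((count (fun x => t <= x) (Lseq h))%:Z : int) =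
  \sum_(k < m + n) b2z (negpos m k) * b2z (t <= h k).
Proof.
rewrite count_map count_filter -sum1_count big_enum_cond /= big_mkcond /=.
rewrite -[RHS]/(\sum_(k < m + n) _) (big_morph Posz PoszD (erefl 0%:Z)).
by apply: eq_bigr => k _; rewrite /=; case: (negpos m k); case: (t <= h k).
Qed.

(** An upward step brings the larger of two values to the earlier position, and the negative
    positions come first. *)
Lemma count_Lseq_lt f g t : bruhat_lt g f ->
  (count (fun x => (t <= x)%R) (Lseq g) <= count (fun x => (t <= x)%R) (Lseq f))%N.
Proof.
elim=> [x _ [i [j [ij [xij ->]]]]|x y z _ xy _ yz]; last exact: leq_trans xy yz.
rewrite -lez_nat !count_Lseq.
under [in leRHS]eq_bigr => k _ do rewrite ffunE.
rewrite (sum_tperm _ (fun k => b2z (t <= x k))); last first.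
  by apply/eqP => eij; rewrite eij ltnn in ij.
rewrite lerDl mulr_ge0 // /b2z; first by rewrite /negpos; lia.
by case: (leP t (x i)) => ?; case: (leP t (x j)) => ?; lia.
Qed.

Lemma values_lt f g : bruhat_lt g f -> perm_eq (Lseq g ++ Rseq g) (Lseq f ++ Rseq f).
Proof.
have all_values h : perm_eq (Lseq h ++ Rseq h) [seq h k | k <- enum 'I_(m + n)].
  rewrite /Lseq /Rseq -map_cat; apply: perm_map.
  exact/permPl/(perm_filterC (fun k => negpos m k)).
elim=> [x _ [i [j [ij [xij ->]]]]|x y z _ xy _ yz]; last exact: perm_trans xy yz.
rewrite (permPl (all_values _)) perm_sym (permPl (all_values _)).
have -> : [seq [ffun k => x (tperm i j k)] k | k <- enum 'I_(m + n)] =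
    [seq x k | k <- [seq tperm i j k | k <- enum 'I_(m + n)]].
  by rewrite -[RHS]map_comp; apply: eq_map => k; rewrite ffunE.
apply: perm_map; apply: uniq_perm; rewrite ?enum_uniq //.
  by rewrite map_inj_uniq ?enum_uniq //; apply: perm_inj.
by move=> k; rewrite mem_enum -[k](tpermK i j) map_f // mem_enum.
Qed.

Lemma multiplicity_lt f g x : dominant f -> dominant g -> bruhat_lt g f ->
  (inL g x + inR g x = inL f x + inR f x)%N.
Proof.
move=> df dg /values_lt/seq.permP/(_ (pred1 x)).
rewrite !count_cat !count_uniq_mem ?uniq_Lseq ?uniq_Rseq //.
by rewrite !mem_Lseq !mem_Rseq.
Qed.

(* Below [f] in the Bruhat ordering the values at negative positions only get
   smaller, whereas here they already are the smallest possible. *)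
Lemma J_typicalP f : dominant f ->
  (forall a b, only (inL f) (inR f) a -> only (inR f) (inL f) b -> a < b) ->
  J_typical f.
Proof.
move=> df sep; split=> // g dg gf.
have mult x := multiplicity_lt x df dg gf.
have [/allP sub|/allPn[y gy fy]] := boolP (all (fun x => x \in Lseq f) (Lseq g)).
  have [|_ eL] := uniq_min_size (uniq_Lseq dg) sub; first by rewrite !size_map.
  have fgL : inL g = inL f by apply/funext => x; rewrite -!mem_Lseq eL.
  have fgR : inR g = inR f.
    apply/funext => x; have := mult x; rewrite fgL => /addnI.
    by case: (inR g x); case: (inR f x).
  by apply: (@bruhat_irr f); rewrite -{1}(dominant_inj dg df).
have := count_Lseq_lt y gf; rewrite leqNgt => /negP; apply.
rewrite -!size_filter.
have y_only : only (inR f) (inL f) y.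
  move: gy fy; rewrite !mem_Lseq /only => gy /negbTE fy.
  by have := mult y; rewrite gy fy; case: (inR f y).
apply: (@uniq_leq_size _ (y :: [seq x <- Lseq f | y <= x])) => [|x].
  by rewrite /= filter_uniq ?uniq_Lseq // mem_filter (negbTE fy) andbF.
rewrite inE mem_filter [in X in _ -> X]mem_filter => /orP[/eqP ->|/andP[yx fx]].
  by rewrite lexx gy.
rewrite yx /=; apply: contraLR yx => gx; rewrite -ltNge; apply: sep y_only.
move: gx fx; rewrite !mem_Lseq /only => /negbTE gx fx.
by have := mult x; rewrite gx fx; case: (inR f x); case: (inR g x).
Qed.

(** What remains of dominance after values have been exchanged but before the blocks are sorted
    again. *)
Definition block_inj h := forall i j, negpos m i = negpos m j -> h i = h j -> i = j.

Lemma dominant_block_inj f : dominant f -> block_inj f.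
Proof.
move=> df i j ij fij; apply/eqP/contraT; rewrite neq_ltn => /orP[] lt_ij.
  by have := df i j lt_ij; rewrite fij ltxx ij; case: (negpos m j) => /(_ isT).
by have := df j i lt_ij; rewrite fij ltxx ij; case: (negpos m j) => /(_ isT).
Qed.

Lemma block_inj_shL h a b : ~~ inL h b -> block_inj h -> block_inj (shL h a b).
Proof.
move=> hb hinj i j ij; rewrite !ffunE ij => hij; apply: hinj => //; move: hij ij.
case j1: (negpos m j) => //= hij i1.
have nb k : negpos m k -> h k != b.
  by move=> k1; apply: contraNneq hb => <-; apply/inLP; exists k.
by have := nb i i1; have := nb j j1; move: hij; do 2 case: ifP; move=> /eqP + /eqP; lia.
Qed.

Lemma block_inj_shR h a b : ~~ inR h b -> block_inj h -> block_inj (shR h a b).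
Proof.
move=> hb hinj i j ij; rewrite !ffunE ij => hij; apply: hinj => //; move: hij ij.
case j1: (negpos m j) => //= hij i1.
have nb k : ~~ negpos m k -> h k != b.
  by move=> k1; apply: contraNneq hb => <-; apply/inRP; exists k.
have := nb i; have := nb j; rewrite i1 j1 => /(_ isT) + /(_ isT).
by move: hij; do 2 case: ifP; move=> /eqP + /eqP; lia.
Qed.

(** Among the rearrangements of [h] within blocks that are equal to or above [h], take one of least
    energy. An ascent inside a block would allow a further upward step of smaller energy, so this
    rearrangement is dominant, and its value sets identify it with [f]. *)
Lemma bruhat_dominant_max f h : dominant f -> block_inj h ->
  inL h = inL f -> inR h = inR f -> h = f \/ bruhat_lt h f.
Proof.
move=> df hinj hL hR.
pose hs (s : 'S_(m + n)) : Zmn m n := [ffun k => h (s k)].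
pose P (s : 'S_(m + n)) := (hs s = h \/ bruhat_lt h (hs s)) /\
  (forall k, negpos m (s k) = negpos m k).
have hs1 : hs 1%g = h by apply/ffunP => k; rewrite ffunE perm1.
have P1 : `[<P 1%g>].
  by apply/asboolP; split=> [|k]; [left | rewrite perm1].
case: (@arg_minP _ _ _ (1%g : 'S_(m + n)) (fun s => `[<P s>]) (fun s => energy (hs s)) P1) => s /asboolP[hhs sblk] smin.
have dhs : dominant (hs s).
  move=> i j ij blk; rewrite ltNge; apply/negP => le_ij.
  have eq_blk : negpos m i = negpos m j.
    by move: blk ij; rewrite /negpos; lia.
  have lt_ij : hs s i < hs s j.
    rewrite lt_neqAle le_ij andbT; apply/eqP; rewrite !ffunE => /hinj.
    rewrite !sblk => /(_ eq_blk)/perm_inj eij; by rewrite eij ltnn in ij.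
  have st : bruhat_step (hs s) (hs (tperm i j * s)%g).
    by exists i, j; do 2 split=> //; apply/ffunP => k; rewrite !ffunE permM.
  have /smin : `[<P (tperm i j * s)%g>].
    apply/asboolP; split.
      right; case: hhs => [<-|hhs]; first exact: t_step.
      by apply: t_trans hhs _; apply: t_step.
    by move=> k; rewrite permM sblk; case: tpermP => // ->; rewrite eq_blk.
  by rewrite leNgt energy_step.
have <- : hs s = f; last by case: hhs; [left|right].
apply: dominant_inj => //; rewrite -?hL -?hR; apply/funext => x.
  apply/inLP/inLP => -[k k1 <-]; first by exists (s k); rewrite ?sblk ?ffunE.
  by exists ((s^-1)%g k); rewrite -1?sblk ?ffunE permKV.
apply/inRP/inRP => -[k k1 <-]; first by exists (s k); rewrite ?sblk ?ffunE.
by exists ((s^-1)%g k); rewrite -1?sblk ?ffunE permKV.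
Qed.

(** Exchanging [a] and [b] back in [g] is one upward step to some [h], dominant or not; sorting the
    blocks of [h] leads further up to [f]. *)
Lemma bruhat_swap f g a b : dominant f -> dominant g ->
  only (inL f) (inR f) a -> only (inR f) (inL f) b -> b < a ->
  inL g = move_val (inL f) a b -> inR g = move_val (inR f) b a -> bruhat_lt g f.
Proof.
move=> df dg /andP[La Ra] /andP[Rb Lb] ba gL gR.
have [ab ab'] : a != b /\ b != a by split; lia.
have gLb : inL g b by rewrite gL move_val_to.
have gRa : inR g a by rewrite gR move_val_to.
have gLa : ~~ inL g a by rewrite gL move_val_from.
have gRb : ~~ inR g b by rewrite gR move_val_from.
have [/inLP[i i1 gi] /inRP[j j1 gj]] := (gLb, gRa).
have ginj := dominant_block_inj dg.
pose h : Zmn m n := [ffun k => g (tperm i j k)].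
(* Since values are distinct within each block, the transposition of positions is a replacement of
   values, whose value sets are known. *)
have hE : h = shR (shL g b a) a b.
  apply/ffunP => k; rewrite !ffunE; case k1: (negpos m k) => /=.
    have -> : (g k == b) = (k == i).
      by apply/eqP/eqP => [gk|->//]; apply: ginj; rewrite ?k1 ?i1 ?gk.
    case: tpermP => [->|kj|/eqP/negbTE ->] //; first by rewrite eqxx.
    by rewrite -kj k1 in j1.
  have -> : (g k == a) = (k == j).
    by apply/eqP/eqP => [gk|->//]; apply: ginj; rewrite ?k1 ?(negbTE j1) ?gk.
  case: tpermP => [ki|->|_ /eqP/negbTE ->] //; last by rewrite eqxx.
  by rewrite ki i1 in k1.
have gh : bruhat_lt g h.
  apply: t_step; exists i, j; rewrite gi gj; split=> //.
  by move: i1 j1; rewrite /negpos; lia.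
have hL : inL h = inL f by rewrite hE inL_shR inL_shL // gL move_valK.
have hR : inR h = inR f by rewrite hE inR_shR ?inR_shL // gR move_valK.
have hinj : block_inj h.
  by rewrite hE; apply: block_inj_shR; rewrite ?inR_shL //; apply: block_inj_shL.
have [<-//|] := bruhat_dominant_max df hinj hL hR; exact: t_trans.
Qed.

End Bruhat.

(** * Bar invariance of cup sums *)

Fixpoint cup_sum m n (M : seq (int * int)) (L R : pred int) : Fock m n :=
  if M is p :: M' then
    fun g => cup_sum M' L R g +
      qq * cup_sum M' (move_val L p.1 p.2) (move_val R p.2 p.1) g
  else weight_vector m n L R.

Arguments cup_sum m n M L R : clear implicits.

(** Cups are listed so that inner ones precede outer ones. [lo] and [ro] hold the closing and
    opening integers not consumed by earlier cups, and none of these may lie inside the current cup.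
    The final condition is the criterion of [J_typicalP] for what is left unmatched. *)
Fixpoint noncrossing (M : seq (int * int)) (lo ro : pred int) : Prop :=
  if M is p :: M' then
    [/\ lo p.1, ro p.2, p.2 < p.1, forall x, p.2 < x < p.1 -> ~~ lo x && ~~ ro x &
        noncrossing M' (fun x => (x != p.1) && lo x) (fun x => (x != p.2) && ro x)]
  else forall a b, lo a -> ro b -> a < b.

Definition avoids (x : int) (M : seq (int * int)) : bool :=
  all (fun p => (p.1 != x) && (p.2 != x)) M.

Lemma noncrossing_avoids M (lo ro : pred int) x : noncrossing M lo ro ->
  ~~ lo x -> ~~ ro x -> avoids x M.
Proof.
elim: M lo ro => [//|p M IH] lo ro /= [lop rop _ _ /IH{}IH] lox rox.
rewrite IH ?(negbTE lox) ?(negbTE rox) ?andbF // andbT.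
by apply/andP; split; [apply: contraNneq lox => <- | apply: contraNneq rox => <-].
Qed.

(** Moving [a] to [b] in [L] makes [b] full and [a] empty, so both endpoints disappear from the
    matching and the rest of it is untouched. *)
Lemma only_cup (L R : pred int) (a b : int) : only L R a -> only R L b ->
  only (move_val L a b) R = (fun x => (x != a) && only L R x) /\
  only R (move_val L a b) = (fun x => (x != b) && only R L x).
Proof.
rewrite /only => /andP[La /negbTE Ra] /andP[Rb /negbTE Lb].
split; apply/funext => x; rewrite /move_val.
  by have [->|xa] //= := eqVneq x a; have [->|xb] //= := eqVneq x b; rewrite Rb Lb.
have [->|xa] //= := eqVneq x a; first by rewrite Ra andbF.
by have [->|xb] //= := eqVneq x b; rewrite Rb.
Qed.

(** The opening integer [b] trades places with the full integer [y]; everything else in the matching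
    stays. *)
Lemma only_shift_full (L R : pred int) (b y : int) : only R L b -> L y -> R y ->
  only (move_val L y b) R = only L R /\
  (fun x => (x != y) && only R (move_val L y b) x) = (fun x => (x != b) && only R L x).
Proof.
rewrite /only => /andP[Rb /negbTE Lb] Ly Ry.
split; apply/funext => x; rewrite /move_val.
  have [->|xa] //= := eqVneq x y; first by rewrite Ry andbF.
  by have [->|xb] //= := eqVneq x b; rewrite Rb Lb.
have [->|xa] //= := eqVneq x y; first by rewrite Ly !andbF.
by have [->|xb] //= := eqVneq x b; rewrite Rb.
Qed.

(** The same trade with an empty integer [y], now carried out in [R]. *)
Lemma only_shift_empty (L R : pred int) (b y : int) : only R L b -> ~~ L y -> ~~ R y ->
  only L (move_val R b y) = only L R /\
  (fun x => (x != y) && only (move_val R b y) L x) = (fun x => (x != b) && only R L x).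
Proof.
rewrite /only => /andP[Rb /negbTE Lb] /negbTE Ly /negbTE Ry.
split; apply/funext => x; rewrite /move_val.
  have [->|xa] //= := eqVneq x b; first by rewrite Lb.
  by have [->|xb] //= := eqVneq x y; rewrite Ly.
have [->|xa] //= := eqVneq x y; first by rewrite Ry andbF.
by have [->|xb] //= := eqVneq x b.
Qed.

Section CupSum.
Variables m n : nat.
Implicit Types (g : Zmn m n) (L R : pred int) (a b : int) (u v : Fock m n).

Lemma actF_lin a u v (c : Qq) g :
  actF a (fun h => u h + c * v h) g = actF a u g + c * actF a v g.
Proof. by rewrite /actF; do 2 case: ifP => _; ring. Qed.

Lemma actE_lin a u v (c : Qq) g :
  actE a (fun h => u h + c * v h) g = actE a u g + c * actE a v g.
Proof. by rewrite /actE; do 2 case: ifP => _; ring. Qed.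

(** The exchanges along [M] touch neither [a] nor [a + 1], so they commute with the moves and leave
    guards and exponents the same in every term. *)
Lemma actF_cup_sum M a L R g : avoids a M -> avoids (a + 1) M ->
  actF a (cup_sum m n M L R) g =
  (L a && ~~ L (a + 1))%:R * cup_sum m n M (move_val L a (a + 1)) R g +
  (R a && ~~ R (a + 1))%:R * qq ^ (b2z (L a) - b2z (L (a + 1))) *
    cup_sum m n M L (move_val R a (a + 1)) g.
Proof.
elim: M L R g => [|[x y] M IH] L R g /=; first by rewrite actF_weight_vector.
move=> /andP[/andP[xa ya] Ma] /andP[/andP[xb yb] Mb].
rewrite actF_lin !IH //= !move_val_out // 1?eq_sym //.
rewrite (move_valC L xb ya) (move_valC R yb xa).
ring.
Qed.

Lemma actE_cup_sum M a L R g : avoids a M -> avoids (a + 1) M ->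
  actE a (cup_sum m n M L R) g =
  (R (a + 1) && ~~ R a)%:R * cup_sum m n M L (move_val R (a + 1) a) g +
  (L (a + 1) && ~~ L a)%:R * qq ^ (b2z (R (a + 1)) - b2z (R a)) *
    cup_sum m n M (move_val L (a + 1) a) R g.
Proof.
elim: M L R g => [|[x y] M IH] L R g /=; first by rewrite actE_weight_vector.
move=> /andP[/andP[xa ya] Ma] /andP[/andP[xb yb] Mb].
rewrite actE_lin !IH //= !move_val_out // 1?eq_sym //.
rewrite (move_valC L xa yb) (move_valC R ya xb).
ring.
Qed.

Lemma inE_weight_vector L R : Defs.inE (weight_vector m n L R).
Proof.
split=> [|g /weight_vector_neq0[]//].
have [[f [df fL fR]]|no] := pselect (exists f : Zmn m n, [/\ dominant f, inL f = L & inR f = R]).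
  exists [:: f] => g /weight_vector_neq0[dg gL gR]; rewrite inE.
  by apply/eqP/dominant_inj => //; rewrite ?gL ?gR.
exists [::] => g /weight_vector_neq0 gw; case: no; exists g; exact: gw.
Qed.

Lemma inE_lin u v (c : Qq) : Defs.inE u -> Defs.inE v -> Defs.inE (fun g => u g + c * v g).
Proof.
move=> [[s us] ud] [[t vt] vd].
have uv g : u g + c * v g != 0 -> (u g != 0) || (v g != 0).
  have [->|_ _] := eqVneq (u g) 0; last exact: orTb.
  by have [->|] := eqVneq (v g) 0; rewrite // mulr0 addr0 eqxx.
split=> [|g /uv /orP[/ud|/vd]//].
by exists (s ++ t) => g /uv; rewrite mem_cat => /orP[/us|/vt] ->; rewrite ?orbT.
Qed.

Lemma inE_cup_sum M L R : Defs.inE (cup_sum m n M L R).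
Proof.
elim: M L R => [|p M IH] L R /=; first exact: inE_weight_vector.
exact: inE_lin.
Qed.

Lemma weight_vector_dominant (f : Zmn m n) : dominant f ->
  weight_vector m n (inL f) (inR f) = Kmon f.
Proof.
move=> df; apply/funext => g; rewrite /weight_vector /Kmon.
case: asboolP => [[dg [gL gR]]|]; first by rewrite (dominant_inj dg df) ?eqxx.
by case: eqVneq => // -> [].
Qed.

Lemma bar0 psi u : is_bar_involution psi -> (forall g, u g = 0) -> psi u = fun=> 0.
Proof.
move=> [_ [psiD _]] u0.
have Eu : Defs.inE u by split=> [|g]; [exists [::] => g|]; rewrite u0 eqxx.
apply/funext => g; have := congr1 (fun v : Fock m n => v g) (psiD _ _ Eu Eu).
rewrite (_ : addF u u = u); last by apply/funext => h; rewrite /addF !u0 addr0.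
by rewrite /addF -{1}[psi _ g]addr0 => /addrI <-.
Qed.

(* The innermost cup (a, b) is shortened, by commuting the entry b past the
   full or empty vertex b + 1, until it becomes the length one cup created by
   F_b from a full vertex followed by an empty one. *)
Lemma bar_cup_sum (psi : Fock m n -> Fock m n) M L R :
  is_bar_involution psi -> noncrossing M (only L R) (only R L) ->
  psi (cup_sum m n M L R) = cup_sum m n M L R.
Proof.
move=> bar_psi; have [_ [_ [_ [psiJ [psiE [psiF _]]]]]] := bar_psi.
elim: M L R => [|[a b] M IH] L R.
  move=> nc /=.
  have [[f [df fL fR]]|no] := pselect (exists f : Zmn m n, [/\ dominant f, inL f = L & inR f = R]).
    rewrite -fL -fR weight_vector_dominant //; apply: psiJ.
    by apply: J_typicalP => //; rewrite fL fR.
  have w0 : weight_vector m n L R = fun=> 0.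
    apply/funext => g; apply/eqP/contraT => /weight_vector_neq0 gw.
    by case: no; exists g.
  by rewrite w0; apply: bar0.
move=> /= [La Rb ab btw ncM].
have [k def_a] : exists k : nat, a = b + k.+1%:Z.
  by exists `|a - b|.-1%N; move: ab => /=; clear; lia.
(* Induction on the length of the head cup with [M] fixed. Shortening the cup preserves [ncM], whose
   predicates omit both endpoints of the cup. *)
elim: k b L R def_a La Rb ab btw ncM => [|k IHk] b L R def_a La Rb ab btw ncM;
  have /andP[La1 Ra1] := La; have /andP[Rb1 Lb1] := Rb;
  have [anb bna] : a != b /\ b != a by rewrite gt_eqF // lt_eqF.
  have ba : a = b + 1 := def_a.
  have [oL oR] := only_cup La Rb.
  have Eu := inE_cup_sum M (move_val L a b) R.
  have fix_u : psi (cup_sum m n M (move_val L a b) R) = cup_sum m n M (move_val L a b) R.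
    by apply: IH; rewrite oL oR.
  rewrite -/(cup_sum m n ((a, b) :: M) L R).
  have -> : cup_sum m n ((a, b) :: M) L R = actF b (cup_sum m n M (move_val L a b) R).
    apply/funext => g; rewrite actF_cup_sum -?ba; first last.
    - by apply: (noncrossing_avoids ncM); rewrite ?eqxx //= /only (negbTE Ra1) andbF.
    - by apply: (noncrossing_avoids ncM); rewrite ?eqxx //= /only (negbTE Lb1) andbF.
    rewrite move_val_to // move_val_from Rb1 Ra1 /= move_valK //.
    by rewrite !mul1r /b2z subr0 expr1z.
  by rewrite psiF // fix_u.
have [y def_y] : exists y : int, y = b + 1 by exists (b + 1).
have a_y : a = y + k.+1%:Z by move: def_a def_y; clear; lia.
have y_a : y < a by rewrite a_y ltrDl.
have b_y : b < y by rewrite def_y ltrDl.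
have [yna ay] : y != a /\ a != y by rewrite lt_eqF // gt_eqF.
have [by' yb] : b != y /\ y != b by rewrite lt_eqF // gt_eqF.
have btw_y x : y < x < a -> [/\ b < x < a, x != y & x != b].
  move=> /andP[y_x ->]; have b_x := lt_trans b_y y_x.
  by rewrite b_x !gt_eqF.
have /andP[oy1 oy2] : ~~ only L R y && ~~ only R L y by apply: btw; rewrite b_y.
have avb : avoids b M.
  by apply: (noncrossing_avoids ncM); rewrite ?eqxx //= /only (negbTE Lb1) andbF.
have avy : avoids y M.
  by apply: (noncrossing_avoids ncM); rewrite ?(negbTE oy1) ?(negbTE oy2) andbF.
have [Ly|Ly] := boolP (L y).
  have Ry : R y by move: oy1; rewrite /only Ly /= negbK.
  have [oL oR] := only_shift_full Rb Ly Ry.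
  have fix_u : psi (cup_sum m n ((a, y) :: M) (move_val L y b) R) =
      cup_sum m n ((a, y) :: M) (move_val L y b) R.
    apply: IHk; rewrite ?oL ?oR //.
      by rewrite /only Ry move_val_from.
    by move=> x /btw_y[bxa xy xb]; have := btw x bxa; rewrite /only move_val_out.
  rewrite -/(cup_sum m n ((a, b) :: M) L R).
  (* In the unexchanged term only the entry [b] of the left factor can move to [y]. In the exchanged
     term [y] is occupied on the left, and only the right entry moves, with exponent 1 - 1 = 0. *)
  have -> : cup_sum m n ((a, b) :: M) L R =
      actF b (cup_sum m n ((a, y) :: M) (move_val L y b) R).
    apply/funext => g; rewrite [in RHS]/= actF_lin !actF_cup_sum -?def_y //=.
    rewrite move_val_to // move_val_from Ry Rb1 move_valK //=.
    rewrite (move_val_out _ bna) // move_val_to // move_val_to //=.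
    rewrite (move_val_out R by') // Rb1 move_val_from /=.
    rewrite !move_val_trans_full // /b2z subrr expr0z; ring.
  by rewrite psiF ?fix_u //; apply: inE_cup_sum.
have Ry : ~~ R y by move: oy2; rewrite /only Ly /= andbT.
have [oL oR] := only_shift_empty Rb Ly Ry.
have fix_u : psi (cup_sum m n ((a, y) :: M) L (move_val R b y)) =
    cup_sum m n ((a, y) :: M) L (move_val R b y).
  apply: IHk; rewrite ?oL ?oR //.
    by rewrite /only Ly andbT move_val_to.
  by move=> x /btw_y[bxa xy xb]; have := btw x bxa; rewrite /only move_val_out.
rewrite -/(cup_sum m n ((a, b) :: M) L R).
(* Dually, E_b moves [y] to [b] on the right in the unexchanged term and on the left in the
   exchanged one, there with exponent 0 - 0. *)
have -> : cup_sum m n ((a, b) :: M) L R =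
    actE b (cup_sum m n ((a, y) :: M) L (move_val R b y)).
  apply/funext => g; rewrite [in RHS]/= actE_lin !actE_cup_sum -?def_y //=.
  rewrite move_val_to // move_val_from (negbTE Ly) move_valK //=.
  rewrite move_val_to // (move_val_out _ bna by') (negbTE Lb1) /=.
  rewrite move_val_from (move_val_out _ by' bna) move_val_from /=.
  rewrite !move_val_trans_empty // /b2z subrr expr0z; ring.
by rewrite psiE ?fix_u //; apply: inE_cup_sum.
Qed.

End CupSum.

(** * The bar map of Q(q) and uniqueness *)

Section BarQ.
Implicit Types (p : {poly rat}) (x : Qq).

Local Notation fracC := (@FracField.tofrac {poly rat} \o @polyC rat).

Lemma qq_neq0 : qq != 0.
Proof. by rewrite tofrac_eq0 polyX_eq0. Qed.

Lemma ev_qinvM p r : ev_qinv (p * r) = ev_qinv p * ev_qinv r.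
Proof.
by rewrite /ev_qinv (rmorphM (map_poly fracC)) hornerM.
Qed.

Lemma ev_qinvX : ev_qinv 'X = qq^-1.
Proof. by rewrite /ev_qinv (map_polyX fracC) hornerX. Qed.

(** Clearing the denominators of p(1/q) reverses the coefficients, which brings the bar map back to
    polynomials, where sizes can be compared. *)
Lemma ev_qinv_rev p N : (size p <= N.+1)%N ->
  qq ^+ N * ev_qinv p = FracField.tofrac (\poly_(i < N.+1) p`_(N - i)).
Proof.
move=> pN.
rewrite /ev_qinv (horner_coef_wide (n := N.+1)); last exact: leq_trans (size_poly _ _) pN.
rewrite mulr_sumr poly_def rmorph_sum /= [RHS](reindex_inj rev_ord_inj) /=.
apply: eq_bigr => i _; have iN : (i <= N)%N by rewrite -ltnS.
rewrite (coef_map fracC) /= subSS subKn //.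
rewrite -mul_polyC rmorphM /= tofracXn mulrCA; congr (_ * _).
by rewrite -/qq exprVn -exprB ?unitfE ?qq_neq0.
Qed.

Lemma ev_qinv_neq0 p : p != 0 -> ev_qinv p != 0.
Proof.
move=> p0; apply: contraNneq p0 => ep.
have := @ev_qinv_rev p (size p) (leqnSn _); rewrite ep mulr0 => /esym/eqP.
rewrite tofrac_eq0 => /eqP rev0; apply/eqP/polyP => i; rewrite coef0.
have [ip|/(nth_default 0)//] := ltnP i (size p).
have := congr1 (fun r : {poly rat} => r`_(size p - i)) rev0.
by rewrite coef0 coef_poly ltnS leq_subr subKn // ltnW.
Qed.

(** The representative chosen by [repr] need not be p/1, but its numerator is p times its
    denominator; the evaluated denominators are nonzero and cancel. *)
Lemma barQ_tofrac p : barQ (FracField.tofrac p) = ev_qinv p.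
Proof.
rewrite /barQ; set r := repr _.
have num_den : \n_r = p * \d_r.
  have := reprK (FracField.tofrac p); rewrite -/r; unlock FracField.tofrac => /eqP.
  rewrite FracField.equivf_def !numden_Ratio ?oner_neq0 // mulr1 => /eqP ->.
  exact: mulrC.
by rewrite num_den ev_qinvM mulfK // ev_qinv_neq0 // denom_ratioP.
Qed.

(** A nonzero q r(q) has only positive powers of q and its bar only negative ones. After
    multiplication by q to the power [(size r).+1], the bar side has size at most [(size r).+1],
    while the other is r times a power of X with exponent [size r + 2]. *)
Lemma barQ_fixed_eq0 x : in_qZq x -> barQ x = x -> x = 0.
Proof.
move=> [p ->]; set r := map_poly _ p; rewrite -tofracM barQ_tofrac ev_qinvM ev_qinvX.
have [->|r0] := eqVneq r 0; first by rewrite mulr0 tofrac0.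
move/(congr1 (fun y => qq ^+ (size r).+1 * y)).
rewrite {1}exprSr -mulrA [qq * _]mulrA divff ?qq_neq0 // mul1r ev_qinv_rev // -tofracXn -tofracM => /eqP.
rewrite tofrac_eq => /eqP/(congr1 (fun p : {poly rat} => size p)) sz.
have := size_poly (size r).+1 (fun i => r`_(size r - i)); rewrite sz.
by rewrite mulrA -exprSr mulrC size_mulXn //; have := size_poly_gt0 r; rewrite r0; lia.
Qed.

End BarQ.

Lemma in_qZq0 : in_qZq 0.
Proof. by exists 0; rewrite rmorph0 tofrac0 mulr0. Qed.

Lemma in_qZqD x y : in_qZq x -> in_qZq y -> in_qZq (x + y).
Proof.
by move=> [p ->] [r ->]; exists (p + r); rewrite rmorphD /= tofracD mulrDr.
Qed.

Lemma in_qZqB x y : in_qZq x -> in_qZq y -> in_qZq (x - y).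
Proof.
by move=> [p ->] [r ->]; exists (p - r); rewrite rmorphB /= tofracB mulrBr.
Qed.

Section Uniqueness.
Variables (m n : nat) (psi : Fock m n -> Fock m n).
Hypothesis bar_psi : is_bar_involution psi.
Implicit Types (f g h : Zmn m n) (u v w : Fock m n).

Lemma inE_finite w (s : seq (Zmn m n)) : (forall h, h \in s -> dominant h) ->
  (forall g, w g != 0 -> g \in s) -> Defs.inE w.
Proof. by move=> sd ws; split=> [|g /ws /sd //]; exists s. Qed.

(** Additivity and anti-linearity of [psi] are available only on [inE] vectors, so monomials are
    split off one at a time with membership checked at each step. *)
Lemma bar_expand w (s : seq (Zmn m n)) g : uniq s ->
  (forall h, h \in s -> dominant h) -> (forall h, w h != 0 -> h \in s) ->
  psi w g = \sum_(h <- s) barQ (w h) * psi (Kmon h) g.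
Proof.
have [_ [psiD [psiZ _]]] := bar_psi.
elim: s w => [|h s IH] w /=.
  move=> _ _ w0; rewrite big_nil (bar0 bar_psi) // => h; apply/eqP/contraT => /w0.
  by rewrite in_nil.
move=> /andP[hs us] sd ws.
pose w' : Fock m n := fun k => if k == h then 0 else w k.
have sd' k : k \in s -> dominant k by move=> ks; apply: sd; rewrite inE ks orbT.
have ws' k : w' k != 0 -> k \in s.
  rewrite /w'; case: (eqVneq k h) => [_|kh /ws]; first by rewrite eqxx.
  by rewrite inE (negbTE kh).
have Kh : Defs.inE (Kmon h).
  apply: (@inE_finite _ [:: h]) => k; first by rewrite inE => /eqP ->; apply: sd; rewrite inE eqxx.
  by rewrite /Kmon inE; case: (eqVneq k h) => //; rewrite eqxx.
have Ksh : Defs.inE (scaleF (w h) (Kmon h)).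
  apply: (@inE_finite _ [:: h]) => k; first by rewrite inE => /eqP ->; apply: sd; rewrite inE eqxx.
  by rewrite /scaleF /Kmon inE; case: (eqVneq k h) => //; rewrite mulr0 eqxx.
have defw : w = addF (scaleF (w h) (Kmon h)) w'.
  apply/funext => k; rewrite /addF /scaleF /Kmon /w'.
  by case: (eqVneq k h) => [->|_]; rewrite ?mulr1 ?addr0 // mulr0 add0r.
have Ew' : Defs.inE w' by apply: inE_finite ws'.
rewrite [in LHS]defw (psiD _ _ Ksh Ew') (psiZ _ _ Kh) big_cons.
rewrite /addF /scaleF (IH w' us sd' ws').
congr (_ + _); apply: eq_big_seq => k ks; rewrite /w'.
by have [kh|_] := eqVneq k h; [rewrite -kh ks in hs | ].
Qed.

(* A coefficient of the difference at a Bruhat-maximal element of its support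
   is fixed by the bar map of Q(q), hence zero as it lies in qZ[q]. *)
Lemma canonical_unique f u v : is_canonical psi f u -> is_canonical psi f v -> u = v.
Proof.
move=> [Eu [pu [uf uq]]] [Ev [pv [vf vq]]].
have [_ [psiD [_ [_ [_ [_ [_ [_ [_ psiK]]]]]]]]] := bar_psi.
pose w : Fock m n := fun g => u g - v g.
have [[s us] ud] := Eu; have [[t vt] vd] := Ev.
have wuv g : w g != 0 -> (u g != 0) || (v g != 0).
  rewrite /w; have [->|_ _] := eqVneq (u g) 0; last exact: orTb.
  by have [->|] := eqVneq (v g) 0; rewrite // subr0 eqxx.
pose S := undup [seq g <- s ++ t | w g != 0].
have wS g : (g \in S) = (w g != 0).
  rewrite mem_undup mem_filter andb_idr // => /wuv /orP[/us|/vt];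
  by rewrite mem_cat => ->; rewrite ?orbT.
have Sd g : g \in S -> dominant g by rewrite wS => /wuv /orP[/ud|/vd].
have Ew : Defs.inE w by apply: (inE_finite Sd) => g; rewrite wS.
have pw : psi w = w.
  have : u = addF v w by apply/funext => g; rewrite /addF /w addrC subrK.
  move/(congr1 psi); rewrite psiD // pu pv => e; apply/funext => g.
  by rewrite [RHS]/w [in RHS]e /addF addrAC subrr add0r.
have wq g : in_qZq (w g).
  have qZ (z : Fock m n) : (forall g, g != f -> z g != 0 -> bruhat_lt g f /\ in_qZq (z g)) ->
      g != f -> in_qZq (z g).
    move=> zq gf; have [->|z0] := eqVneq (z g) 0; first exact: in_qZq0.
    by have [] := zq g gf z0.
  have [->|gf] := eqVneq g f; first by rewrite /w uf vf subrr; apply: in_qZq0.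
  exact: (in_qZqB (qZ u uq gf) (qZ v vq gf)).
suff S0 : S = [::].
  apply/funext => g; apply/eqP; rewrite -subr_eq0 -/(w g); apply/contraT.
  by rewrite -wS S0.
case defS: S => [//|g0 S'].
have g0S : g0 \in S by rewrite defS inE eqxx.
(* Least energy implies Bruhat-maximality in [S]: any other [h] in [S] contributing at [g] would lie
   above [g] and have smaller energy. *)
have [g gS gmin] : exists2 g, g \in S & forall h, h \in S -> energy g <= energy h.
  pose o0 : seq_sub S := SeqSub g0S.
  case: (@Order.TotalTheory.arg_minP _ _ _ o0 xpredT (fun o => energy (val o)) isT) => o _ omin.
  by exists (val o); [exact: valP | move=> h hS; apply: (omin (SeqSub hS))].
have Sw h : w h != 0 -> h \in S by rewrite wS.
have := bar_expand g (undup_uniq _) Sd Sw.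
rewrite pw (bigD1_seq g) ?undup_uniq //= big1_seq => [|h /andP[hg hS]].
  have [-> _] := psiK g (Sd g gS); rewrite mulr1 addr0 => /esym wg.
  by have := gS; rewrite wS (barQ_fixed_eq0 (wq g) wg) eqxx.
have [_ /(_ g)] := psiK h (Sd h hS); rewrite eq_sym hg => /(_ isT) gh.
have [->|/gh[/energy_lt lt_hg _]] := eqVneq (psi (Kmon h) g) 0; first by rewrite mulr0.
by have := gmin h hS; rewrite leNgt lt_hg.
Qed.

End Uniqueness.

(** * Cups and positive pairs *)

Lemma absz_sub_between (a b c : int) : b < a < c ->
  (`|a - b| < `|c - b|)%N /\ (`|c - a| < `|c - b|)%N.
Proof. lia. Qed.

Section SigmaPlus.
Variables (m n : nat) (f : Zmn m n).
Hypothesis df : dominant f.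
Implicit Types (p q : ppair m n) (S T : {set ppair m n}) (x : int).

Lemma atypicalP p : atypical f p ->
  [/\ negpos m p.1, ~~ negpos m p.2, f p.2 < f p.1,
      only (inL f) (inR f) (f p.1) & only (inR f) (inL f) (f p.2)].
Proof.
rewrite /only => /and5P[p1 p2 lt_p -> ->]; split=> //; rewrite andbT.
  by apply/inLP; exists p.1.
by apply/inRP; exists p.2.
Qed.

Lemma mem_sig_upto k p :
  (p \in sig_upto f k) = (p \in SigmaPlus f) && (pdist f p <= k)%N.
Proof.
elim: k p => [|k IH] p.
  by rewrite /= in_set0 [p \in SigmaPlus f]inE; case: (pdist f p) => // d; rewrite andbF.
rewrite /= in_setU IH [X in _ || X]inE [in RHS]leq_eqVlt ltnS.
case: (eqVneq (pdist f p) k.+1) => [dp|_]; last by rewrite andbF orbF.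
by rewrite [p \in SigmaPlus f]inE [p \in sig_level _ _]inE dp /= eqxx ltnn andbF andbT.
Qed.

(** The recursion by distance is replaced by one characterization: an atypical pair is accepted
    exactly when it is disjoint from all strictly shorter accepted pairs. *)
Lemma SigmaPlusP p : reflect
  (atypical f p /\
    forall q, q \in SigmaPlus f -> (pdist f q < pdist f p)%N -> pdisjoint p q)
  (p \in SigmaPlus f).
Proof.
rewrite !inE eqxx /=.
apply: (iffP and3P) => [[d0 ap /forallP dis]|[ap dis]].
  split=> // q qS lt_q; apply: (implyP (dis q)); rewrite mem_sig_upto qS /=.
  by rewrite -ltnS prednK.
have d0 : (0 < pdist f p)%N by have [_ _ ? _ _] := atypicalP ap; rewrite /pdist; lia.
split=> //; apply/forallP => q; apply/implyP; rewrite mem_sig_upto => /andP[qS le_q].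
by apply: dis => //; rewrite -(prednK d0) ltnS.
Qed.

Lemma SigmaPlus_atypical p : p \in SigmaPlus f -> atypical f p.
Proof. by case/SigmaPlusP. Qed.

Lemma pdisjointC p q : pdisjoint p q = pdisjoint q p.
Proof. by rewrite /pdisjoint [p.1 == _]eq_sym [p.2 == _]eq_sym. Qed.

(** For unequal distances this is the recursion. For equal distances, one shared entry forces the
    other values to agree, hence also the positions. *)
Lemma SigmaPlus_disjoint p q : p \in SigmaPlus f -> q \in SigmaPlus f ->
  p != q -> pdisjoint p q.
Proof.
move=> pS qS pq.
have /SigmaPlusP[/atypicalP[p1 p2 lt_p _ _] disp] := pS.
have /SigmaPlusP[/atypicalP[q1 q2 lt_q _ _] disq] := qS.
case: (ltngtP (pdist f p) (pdist f q)) => [lt_pq|lt_qp|eq_pq].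
- by rewrite pdisjointC; apply: disq.
- exact: disp.
have finj := dominant_block_inj df.
rewrite /pdisjoint -negb_or; apply: contra pq => pq; apply/eqP.
case: p q p1 p2 lt_p q1 q2 lt_q eq_pq pq {disp disq pS qS} => [i j] [i' j'] /= p1 p2 lt_p q1 q2 lt_q.
rewrite /pdist /= => eq_pq /orP[] /eqP e; move: eq_pq; rewrite e => eq_pq.
  by rewrite (finj j j') ?(negbTE p2) ?(negbTE q2) //; rewrite e in lt_p; lia.
by rewrite (finj i i') ?p1 ?q1 //; rewrite e in lt_p; lia.
Qed.

(** Otherwise pairing the position of [x] with [p.2] gives a shorter atypical pair. No still shorter
    positive pair meets it: at [p.2] it would conflict with [p], at [x] it would be the desired [q].
    So this pair is itself positive, yet it shares [p.2] with [p]. *)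
Lemma SigmaPlus_between_L p x : p \in SigmaPlus f -> f p.2 < x < f p.1 ->
  only (inL f) (inR f) x ->
  exists q, [/\ q \in SigmaPlus f, (pdist f q < pdist f p)%N & f q.1 = x].
Proof.
move=> pS /andP[lt1 lt2] /andP[/[dup] /inLP[i i1 fi] xL xR].
have [//|no] := pselect (exists q, [/\ q \in SigmaPlus f, (pdist f q < pdist f p)%N & f q.1 = x]).
have /SigmaPlusP[ap dis] := pS.
have [p1 p2 lt_p _ /andP[_ pL]] := atypicalP ap.
have lt_d : (pdist f (i, p.2) < pdist f p)%N.
  by rewrite /pdist /= fi; apply: (absz_sub_between _).1; rewrite lt1.
have iS : (i, p.2) \in SigmaPlus f.
  apply/SigmaPlusP; split; first by rewrite /atypical /= i1 p2 fi lt1 xR.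
  move=> q qS lt_q; have lt_qp := ltn_trans lt_q lt_d.
  have := dis q qS lt_qp; rewrite /pdisjoint /= => /andP[_ ->]; rewrite andbT.
  by apply/eqP => eq_i; apply: no; exists q; rewrite -eq_i.
by have := dis _ iS lt_d; rewrite /pdisjoint /= eqxx andbF.
Qed.

Lemma SigmaPlus_between_R p x : p \in SigmaPlus f -> f p.2 < x < f p.1 ->
  only (inR f) (inL f) x ->
  exists q, [/\ q \in SigmaPlus f, (pdist f q < pdist f p)%N & f q.2 = x].
Proof.
move=> pS /andP[lt1 lt2] /andP[/[dup] /inRP[i i1 fi] xR xL].
have [//|no] := pselect (exists q, [/\ q \in SigmaPlus f, (pdist f q < pdist f p)%N & f q.2 = x]).
have /SigmaPlusP[ap dis] := pS.
have [p1 p2 lt_p /andP[_ pR] _] := atypicalP ap.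
have lt_d : (pdist f (p.1, i) < pdist f p)%N.
  by rewrite /pdist /= fi; apply: (absz_sub_between _).2; rewrite lt1.
have iS : (p.1, i) \in SigmaPlus f.
  apply/SigmaPlusP; split; first by rewrite /atypical /= i1 p1 fi lt2 pR.
  move=> q qS lt_q; have lt_qp := ltn_trans lt_q lt_d.
  have := dis q qS lt_qp; rewrite /pdisjoint /= => /andP[-> _] /=.
  by apply/eqP => eq_i; apply: no; exists q; rewrite -eq_i.
by have := dis _ iS lt_d; rewrite /pdisjoint /= eqxx.
Qed.

Definition pair_values p : int * int := (f p.1, f p.2).

(** [l] lists the cups already consumed. Sorting by distance makes the positive pairs found inside a
    cup precede it. At the end of the list, an unmatched pair with b < a would be disjoint from
    every positive pair, hence itself positive. *)
Lemma noncrossing_suffix (l l' : seq (ppair m n)) :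
  l ++ l' =i SigmaPlus f -> uniq (l ++ l') ->
  sorted (relpre (pdist f) leq) (l ++ l') ->
  noncrossing (map pair_values l')
    (fun x => all (fun p => x != f p.1) l && only (inL f) (inR f) x)
    (fun x => all (fun p => x != f p.2) l && only (inR f) (inL f) x).
Proof.
have finj := dominant_block_inj df.
elim: l' l => [|p l' IH] l memS uS sS /=.
  rewrite cats0 in memS => a b /andP[/allP la /andP[/inLP[i i1 fi] aR]].
  move=> /andP[/allP lb /andP[/inRP[j j1 fj] bL]].
  rewrite ltNge le_eqVlt; apply/negP => /orP[/eqP eq_ab|lt_ba].
    by case/negP: bL; rewrite eq_ab; apply/inLP; exists i.
  have : (i, j) \in SigmaPlus f.
    apply/SigmaPlusP; split; first by rewrite /atypical /= i1 j1 fi fj lt_ba aR bL.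
    move=> q; rewrite -memS => ql _; rewrite /pdisjoint /=; apply/andP; split.
      by apply: contraNneq (la q ql) => <-; rewrite fi.
    by apply: contraNneq (lb q ql) => <-; rewrite fj.
  by rewrite -memS => /la; rewrite /= fi eqxx.
have pS : p \in SigmaPlus f by rewrite -memS mem_cat inE eqxx orbT.
have [p1 p2 lt_p pL pR] := atypicalP (SigmaPlus_atypical pS).
have lS q : q \in l -> q \in SigmaPlus f by rewrite -memS mem_cat => ->.
have p_l : p \notin l.
  by move: uS; rewrite cat_uniq /= => /and3P[_ + _]; rewrite negb_or => /andP[].
have dis q : q \in l -> pdisjoint p q.
  by move=> ql; apply: SigmaPlus_disjoint (lS q ql) _ => //; apply: contraNneq p_l => ->.
have small q : q \in SigmaPlus f -> (pdist f q < pdist f p)%N -> q \in l.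
  rewrite -memS mem_cat => /orP[//|qpl]; rewrite ltnNge => /negP[].
  have [_] := cat_sorted2 sS; rewrite /= => /order_path_min => /(_ _)/allP min_p.
  move: qpl; rewrite inE => /orP[/eqP -> //|ql']; apply: min_p ql'.
  by move=> ? ? ?; apply: leq_trans.
split=> //.
- rewrite pL andbT; apply/allP => q ql; apply/eqP => /finj e.
  have /atypicalP[q1 _ _ _ _] := SigmaPlus_atypical (lS q ql).
  by have := dis q ql; rewrite /pdisjoint e ?p1 ?q1 // eqxx.
- rewrite pR andbT; apply/allP => q ql; apply/eqP => /finj e.
  have /atypicalP[_ q2 _ _ _] := SigmaPlus_atypical (lS q ql).
  by have := dis q ql; rewrite /pdisjoint e ?(negbTE p2) ?(negbTE q2) // eqxx andbF.
- move=> x /= btw; apply/andP; split; apply/negP => /andP[/allP lx ox].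
    have [q [qS lt_q fq]] := SigmaPlus_between_L pS btw ox.
    by have := lx q (small q qS lt_q); rewrite fq eqxx.
  have [q [qS lt_q fq]] := SigmaPlus_between_R pS btw ox.
  by have := lx q (small q qS lt_q); rewrite fq eqxx.
have := IH (rcons l p); rewrite cat_rcons => /(_ memS uS sS).
congr (noncrossing _ _ _); apply/funext => x; by rewrite all_rcons /= andbA.
Qed.

(** * Exchanging values along a set of positive pairs *)

Lemma swapvals1 S p : S \subset SigmaPlus f -> p \in S -> swapvals f S p.1 = f p.2.
Proof.
move=> /subsetP SS pS; rewrite ffunE; case: pickP => [q /andP[qS /eqP e]|/(_ p)].
  have [->//|pq] := eqVneq q p.
  by have := SigmaPlus_disjoint (SS q qS) (SS p pS) pq; rewrite /pdisjoint e eqxx.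
by rewrite pS eqxx.
Qed.

Lemma swapvals2 S p : S \subset SigmaPlus f -> p \in S -> swapvals f S p.2 = f p.1.
Proof.
move=> /subsetP SS pS; rewrite ffunE; case: pickP => [q /andP[qS /eqP e]|_].
  have [q1 _ _ _ _] := atypicalP (SigmaPlus_atypical (SS q qS)).
  have [_ p2 _ _ _] := atypicalP (SigmaPlus_atypical (SS p pS)).
  by rewrite -e q1 in p2.
case: pickP => [q /andP[qS /eqP e]|/(_ p)]; last by rewrite pS eqxx.
have [->//|pq] := eqVneq q p.
by have := SigmaPlus_disjoint (SS q qS) (SS p pS) pq; rewrite /pdisjoint e eqxx andbF.
Qed.

Lemma swapvals0 S k : (forall p, p \in S -> (p.1 != k) && (p.2 != k)) ->
  swapvals f S k = f k.
Proof.
move=> Sk; rewrite ffunE; case: pickP => [q /andP[/Sk + e]|_]; first by rewrite e.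
by case: pickP => [q /andP[/Sk + e]|//]; rewrite e andbF.
Qed.

Lemma swapvals_negpos S k : S \subset SigmaPlus f -> negpos m k ->
  swapvals f S k = f k \/ exists p, [/\ p \in S, p.1 = k & swapvals f S k = f p.2].
Proof.
move=> SS k1; case: (pickP (fun p => (p \in S) && (p.1 == k))) => [p /andP[pS /eqP <-]|no].
  by right; exists p; rewrite swapvals1.
left; apply: swapvals0 => p pS; have := no p; rewrite pS /= => -> /=.
have [_ p2 _ _ _] := atypicalP (SigmaPlus_atypical (subsetP SS p pS)).
by apply: contraNneq p2 => ->.
Qed.

Lemma swapvals_notnegpos S k : S \subset SigmaPlus f -> ~~ negpos m k ->
  swapvals f S k = f k \/ exists p, [/\ p \in S, p.2 = k & swapvals f S k = f p.1].
Proof.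
move=> SS k1; case: (pickP (fun p => (p \in S) && (p.2 == k))) => [p /andP[pS /eqP <-]|no].
  by right; exists p; rewrite swapvals2.
left; apply: swapvals0 => p pS; have := no p; rewrite pS /= => -> /=.
have [p1 _ _ _ _] := atypicalP (SigmaPlus_atypical (subsetP SS p pS)).
by rewrite andbT; apply: contraNneq k1 => <-.
Qed.

Section AddPair.
Variables (S : {set ppair m n}) (p : ppair m n).
Hypotheses (SS : S \subset SigmaPlus f) (pSigma : p \in SigmaPlus f) (pS : p \notin S).

Let dis q : q \in S -> pdisjoint q p.
Proof.
move=> qS; apply: SigmaPlus_disjoint => //; first exact: (subsetP SS).
by apply: contraNneq pS => <-.
Qed.

Let p_atyp := atypicalP (SigmaPlus_atypical pSigma).

Let swapvals_p1 : swapvals f S p.1 = f p.1.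
Proof.
have [p1 p2 _ _ _] := p_atyp.
apply: swapvals0 => q qS; have := dis qS; rewrite /pdisjoint => /andP[-> _] /=.
have [_ q2 _ _ _] := atypicalP (SigmaPlus_atypical (subsetP SS q qS)).
by apply: contraNneq q2 => ->.
Qed.

Let swapvals_p2 : swapvals f S p.2 = f p.2.
Proof.
have [p1 p2 _ _ _] := p_atyp.
apply: swapvals0 => q qS; have := dis qS; rewrite /pdisjoint => /andP[_ ->] /=.
have [q1 _ _ _ _] := atypicalP (SigmaPlus_atypical (subsetP SS q qS)).
by rewrite andbT; apply: contraNneq p2 => <-.
Qed.

(** The pairs in [S] share no entry with [p], so their exchanges leave the values of [p] on their
    original sides only. *)
Lemma only_swapvals_L : only (inL (swapvals f S)) (inR (swapvals f S)) (f p.1).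
Proof.
have [p1 p2 lt_p /andP[_ pR] _] := p_atyp.
apply/andP; split; first by apply/inLP; exists p.1.
apply/inRP => -[k k1 sk]; have [e|[q [qS _ e]]] := swapvals_notnegpos SS k1.
  by case/negP: pR; apply/inRP; exists k; rewrite // -e.
have [q1 _ _ _ _] := atypicalP (SigmaPlus_atypical (subsetP SS q qS)).
have e1 : q.1 = p.1 by apply: (dominant_block_inj df); rewrite ?p1 ?q1 // -e sk.
by have := dis qS; rewrite /pdisjoint e1 eqxx.
Qed.

Lemma only_swapvals_R : only (inR (swapvals f S)) (inL (swapvals f S)) (f p.2).
Proof.
have [p1 p2 lt_p _ /andP[_ pL]] := p_atyp.
apply/andP; split; first by apply/inRP; exists p.2.
apply/inLP => -[k k1 sk]; have [e|[q [qS _ e]]] := swapvals_negpos SS k1.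
  by case/negP: pL; apply/inLP; exists k; rewrite // -e.
have [_ q2 _ _ _] := atypicalP (SigmaPlus_atypical (subsetP SS q qS)).
have e1 : q.2 = p.2.
  by apply: (dominant_block_inj df); rewrite ?(negbTE p2) ?(negbTE q2) // -e sk.
by have := dis qS; rewrite /pdisjoint e1 eqxx andbF.
Qed.

(** Turns the simultaneous exchange into one that can be iterated pair by pair, as [cup_sum]
    does. *)
Lemma swapvals_setU1 :
  swapvals f (p |: S) = shR (shL (swapvals f S) (f p.1) (f p.2)) (f p.2) (f p.1).
Proof.
have [p1 p2 lt_p /andP[_ pR] /andP[_ pL]] := p_atyp.
have SS' : p |: S \subset SigmaPlus f by rewrite subUset sub1set pSigma.
have finj := dominant_block_inj df.
apply/ffunP => k; rewrite [in RHS]ffunE [shL _ _ _ k]ffunE.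
have [->|kp1] := eqVneq k p.1.
  by rewrite swapvals_p1 p1 eqxx /= swapvals1 ?setU11.
have [->|kp2] := eqVneq k p.2.
  by rewrite swapvals_p2 (negbTE p2) /= eqxx swapvals2 ?setU11.
have eS : swapvals f (p |: S) k = swapvals f S k.
  case k1: (negpos m k).
    have [e|[q [qS qk e]]] := swapvals_negpos SS k1; last first.
      by rewrite -qk !swapvals1 // in_setU1 qS orbT.
    have [e'|[q [qS qk e']]] := swapvals_negpos SS' k1; first by rewrite e e'.
    move: qS; rewrite in_setU1 => /orP[/eqP qp|qS]; first by rewrite -qk qp eqxx in kp1.
    by rewrite -qk !swapvals1 // in_setU1 qS orbT.
  move/negbT: k1 => k1; have [e|[q [qS qk e]]] := swapvals_notnegpos SS k1; last first.
    by rewrite -qk !swapvals2 // in_setU1 qS orbT.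
  have [e'|[q [qS qk e']]] := swapvals_notnegpos SS' k1; first by rewrite e e'.
  move: qS; rewrite in_setU1 => /orP[/eqP qp|qS]; first by rewrite -qk qp eqxx in kp2.
  by rewrite -qk !swapvals2 // in_setU1 qS orbT.
rewrite eS; case k1: (negpos m k) => /=.
  case: eqP => // sk; have [e|[q [qS qk e]]] := swapvals_negpos SS k1.
    by case/eqP: kp1; apply: finj; rewrite ?k1 ?p1 // -e sk.
  have [_ q2 _ _ _] := atypicalP (SigmaPlus_atypical (subsetP SS q qS)).
  by case/negP: pR; apply/inRP; exists q.2; rewrite // -e.
case: eqP => // sk; have [e|[q [qS qk e]]] := swapvals_notnegpos SS (negbT k1).
  by case/eqP: kp2; apply: finj; rewrite ?k1 ?(negbTE p2) // -e sk.
have [q1 _ _ _ _] := atypicalP (SigmaPlus_atypical (subsetP SS q qS)).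
by case/negP: pL; apply/inLP; exists q.1; rewrite // -e.
Qed.

Lemma inL_swapvals_setU1 :
  inL (swapvals f (p |: S)) = move_val (inL (swapvals f S)) (f p.1) (f p.2).
Proof.
have [/andP[? ?] /andP[? ?]] := (only_swapvals_L, only_swapvals_R).
by rewrite swapvals_setU1 inL_shR inL_shL.
Qed.

Lemma inR_swapvals_setU1 :
  inR (swapvals f (p |: S)) = move_val (inR (swapvals f S)) (f p.2) (f p.1).
Proof.
have [/andP[? ?] /andP[? ?]] := (only_swapvals_L, only_swapvals_R).
by rewrite swapvals_setU1 inR_shR inR_shL.
Qed.

End AddPair.

Lemma swapvals_set0 : swapvals f set0 = f.
Proof. by apply/ffunP => k; apply: swapvals0 => p; rewrite inE. Qed.

Lemma block_inj_swapvals S : S \subset SigmaPlus f -> block_inj (swapvals f S).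
Proof.
have [N] := ubnP #|S|; elim: N S => // N IH S le_S SS.
have [->|[p pS]] := set_0Vmem S; first by rewrite swapvals_set0; apply: dominant_block_inj.
have pS' : p \notin S :\ p by rewrite !inE eqxx.
have SS' : S :\ p \subset SigmaPlus f := subset_trans (subsetDl _ _) SS.
have p_Sigma := subsetP SS p pS.
have /andP[? ?] := only_swapvals_L SS' p_Sigma pS'.
have /andP[? ?] := only_swapvals_R SS' p_Sigma pS'.
rewrite -(setD1K pS) swapvals_setU1 //.
apply: block_inj_shR; rewrite ?inR_shL //; apply: block_inj_shL => //.
by apply: IH => //; move: le_S; rewrite (cardsD1 p) pS.
Qed.
End SigmaPlus.

(** * Rearranging each block in decreasing order *)

Section SortedFunction.
Variables (m n : nat) (h : Zmn m n).
Hypothesis hinj : block_inj h.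

Let geZ := (fun x y : int => y <= x).

(** Chosen so that [fSigma f S] is convertible to [block_sort (swapvals f S)]. *)
Definition block_sort : Zmn m n := [ffun k : 'I_(m + n) =>
  if negpos m k then nth 0 (sort geZ (Lseq h)) k
  else nth 0 (sort geZ (Rseq h)) (k - m)].

Lemma size_Lseq : size (Lseq h) = m.
Proof.
rewrite size_map size_filter -(count_map val (fun i => (i < m)%N)) val_enum_ord.
rewrite iotaD count_cat add0n.
rewrite (@eq_in_count _ _ predT) => [|i]; last by rewrite mem_iota add0n.
rewrite (@eq_in_count _ _ pred0 (iota m n)) => [|i]; last first.
  by rewrite mem_iota => /andP[mi _]; rewrite /= ltnNge mi.
by rewrite count_predT count_pred0 size_iota addn0.
Qed.

Lemma size_Rseq : size (Rseq h) = n.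
Proof.
apply/(@addnI m); rewrite -{1}size_Lseq /Lseq /Rseq !size_map !size_filter.
by rewrite (count_predC (fun k => negpos m k)) size_enum_ord.
Qed.

Lemma uniq_block_values (b : bool) :
  uniq [seq h k | k <- enum 'I_(m + n) & negpos m k == b].
Proof.
rewrite map_inj_in_uniq; first by apply: filter_uniq; apply: enum_uniq.
move=> i j; rewrite !mem_filter => /andP[/eqP ib _] /andP[/eqP jb _].
by apply: hinj; rewrite ib jb.
Qed.

Lemma uniq_Lseq_inj : uniq (Lseq h).
Proof.
by have := uniq_block_values true; under eq_filter => k do rewrite eqb_id.
Qed.

Lemma uniq_Rseq_inj : uniq (Rseq h).
Proof.
by have := uniq_block_values false; under eq_filter => k do rewrite eqbF_neg.
Qed.

Lemma sort_gt (s : seq int) i j : uniq s -> (i < j < size s)%N ->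
  nth 0 (sort geZ s) j < nth 0 (sort geZ s) i.
Proof.
move=> us /andP[ij js]; have is_ := ltn_trans ij js.
rewrite lt_neqAle nth_uniq ?size_sort ?sort_uniq // gtn_eqF //=.
have ge_trans : transitive geZ by move=> y x z yx zy; apply: le_trans zy yx.
have s_sorted : sorted geZ (sort geZ s) by apply: sort_sorted => x y; apply: le_total.
by apply: (sorted_ltn_nth ge_trans 0 s_sorted); rewrite ?inE ?size_sort.
Qed.

Lemma block_sort_dominant : dominant block_sort.
Proof.
move=> i j ij blk; rewrite !ffunE.
case i1: (negpos m i); case j1: (negpos m j).
- by apply: sort_gt uniq_Lseq_inj _; rewrite ij size_Lseq.
- by rewrite i1 j1 in blk.
- by move: i1 j1 ij; rewrite /negpos; lia.
apply: sort_gt uniq_Rseq_inj _; rewrite size_Rseq.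
by have := ltn_ord j; move: i1 j1 ij; rewrite /negpos; lia.
Qed.

Lemma inL_block_sort : inL block_sort = inL h.
Proof.
apply/funext => x; rewrite -[in RHS]mem_Lseq -(mem_sort geZ).
apply/inLP/idP => [[k k1 <-]|xs].
  by rewrite ffunE k1 mem_nth // size_sort size_Lseq.
have lt_m : (index x (sort geZ (Lseq h)) < m)%N.
  by rewrite -[X in (_ < X)%N]size_Lseq -(size_sort geZ) index_mem.
by exists (lshift n (Ordinal lt_m)); rewrite ?ffunE /negpos /= lt_m ?nth_index.
Qed.

Lemma inR_block_sort : inR block_sort = inR h.
Proof.
apply/funext => x; rewrite -[in RHS]mem_Rseq -(mem_sort geZ).
apply/inRP/idP => [[k k1 <-]|xs].
  rewrite ffunE (negbTE k1) mem_nth // size_sort size_Rseq.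
  by have := ltn_ord k; move: k1; rewrite /negpos; lia.
have lt_n : (index x (sort geZ (Rseq h)) < n)%N.
  by rewrite -[X in (_ < X)%N]size_Rseq -(size_sort geZ) index_mem.
exists (rshift m (Ordinal lt_n)); first by rewrite /negpos /= ltnNge leq_addr.
by rewrite ffunE /negpos /= ltnNge leq_addr addKn nth_index.
Qed.

End SortedFunction.

(** * The right-hand side as a cup sum, and its triangularity *)

Section CupSumSigma.
Variables (m n : nat) (f : Zmn m n).
Hypothesis df : dominant f.
Implicit Types (p q : ppair m n) (S T : {set ppair m n}).

Lemma fSigma_dominant S : S \subset SigmaPlus f -> dominant (fSigma f S).
Proof. by move=> SS; apply/block_sort_dominant/block_inj_swapvals. Qed.

Lemma inL_fSigma S : inL (fSigma f S) = inL (swapvals f S).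
Proof. exact: inL_block_sort. Qed.

Lemma inR_fSigma S : inR (fSigma f S) = inR (swapvals f S).
Proof. exact: inR_block_sort. Qed.

Lemma fSigma_set0 : fSigma f set0 = f.
Proof.
apply: dominant_inj => //; first by apply: fSigma_dominant; rewrite sub0set.
  by rewrite inL_fSigma swapvals_set0.
by rewrite inR_fSigma swapvals_set0.
Qed.

(** Pairs are removed one by one, and each removal goes up in the ordering by [bruhat_swap]. *)
Lemma fSigma_lt S : S \subset SigmaPlus f -> S != set0 -> bruhat_lt (fSigma f S) f.
Proof.
have [N] := ubnP #|S|; elim: N S => // N IH S le_S SS /set0Pn[p pS].
have pS' : p \notin S :\ p by rewrite !inE eqxx.
have SS' : S :\ p \subset SigmaPlus f := subset_trans (subsetDl _ _) SS.
have p_Sigma := subsetP SS p pS.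
have [_ _ lt_p _ _] := atypicalP (SigmaPlus_atypical p_Sigma).
have lt1 : bruhat_lt (fSigma f S) (fSigma f (S :\ p)).
  apply: (bruhat_swap (fSigma_dominant SS') (fSigma_dominant SS) _ _ lt_p).
  - by rewrite inL_fSigma inR_fSigma; apply: only_swapvals_L.
  - by rewrite inL_fSigma inR_fSigma; apply: only_swapvals_R.
  - by rewrite !inL_fSigma -{1}(setD1K pS) inL_swapvals_setU1.
  by rewrite !inR_fSigma -{1}(setD1K pS) inR_swapvals_setU1.
have [S0|S0] := eqVneq (S :\ p) set0; first by rewrite S0 fSigma_set0 in lt1.
apply: t_trans lt1 (IH _ _ SS' S0).
by move: le_S; rewrite (cardsD1 p) pS.
Qed.

Lemma weight_vector_fSigma S : S \subset SigmaPlus f ->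
  weight_vector m n (inL (swapvals f S)) (inR (swapvals f S)) = Kmon (fSigma f S).
Proof.
move=> SS; rewrite -(weight_vector_dominant (fSigma_dominant SS)).
by rewrite inL_fSigma inR_fSigma.
Qed.

Lemma big_subset_setU1 (V : nmodType) (A : {set ppair m n}) p
    (F : {set ppair m n} -> V) : p \notin A ->
  \sum_(T : {set ppair m n} | T \subset p |: A) F T =
  \sum_(T : {set ppair m n} | T \subset A) F T +
  \sum_(T : {set ppair m n} | T \subset A) F (p |: T).
Proof.
move=> pA; rewrite (bigID (fun T : {set ppair m n} => p \in T)) /= addrC; congr (_ + _).
  apply: eq_bigl => T; apply/andP/idP => [[TA pT]|TA].
    rewrite -(setU1K pA); apply/subsetD1P; split=> //.
  split; first exact: subset_trans TA (subsetUr _ _).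
  by apply: contra pA; apply: (subsetP TA).
rewrite (reindex_onto (fun T => p |: T) (fun T => T :\ p)) /=; last first.
  by move=> T /andP[_ pT]; rewrite setD1K.
apply: eq_bigl => T; rewrite setU11 andbT.
apply/andP/idP => [[TA /eqP eT]|TA].
  have pT : p \notin T by rewrite -eT !inE eqxx.
  by rewrite -eT -(setU1K pA) setSD.
by rewrite setUS // setU1K //; apply: contra pA; apply: (subsetP TA).
Qed.

(** [S] accumulates the pairs already exchanged. The two terms of [cup_sum] at its head [p]
    correspond to the subsets without and with [p]. *)
Lemma cup_sum_subsets (l : seq (ppair m n)) S g : uniq l ->
  S \subset SigmaPlus f -> (forall p, p \in l -> p \in SigmaPlus f) ->
  (forall p, p \in l -> p \notin S) ->
  cup_sum m n (map (pair_values f) l) (inL (swapvals f S)) (inR (swapvals f S)) g =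
  \sum_(T : {set ppair m n} | T \subset [set p in l])
    qq ^+ #|T| * Kmon (fSigma f (T :|: S)) g.
Proof.
elim: l S => [|p l IH] S /=.
  move=> _ SS _ _; rewrite weight_vector_fSigma //.
  rewrite (big_pred1 set0) ?cards0 ?expr0 ?mul1r ?set0U // => T.
  by rewrite /= -subset0; congr (_ \subset _); apply/setP => q; rewrite !inE.
move=> /andP[pl ul] SS lS ldis.
have lS' q : q \in l -> q \in SigmaPlus f by move=> ql; apply: lS; rewrite inE ql orbT.
have ldis' q : q \in l -> q \notin S by move=> ql; apply: ldis; rewrite inE ql orbT.
have pS : p \in SigmaPlus f by apply: lS; rewrite inE eqxx.
have pnS : p \notin S by apply: ldis; rewrite inE eqxx.
have -> : [set q in p :: l] = p |: [set q in l] by apply/setP => q; rewrite !inE.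
rewrite big_subset_setU1; last by rewrite inE.
rewrite IH //; congr (_ + _).
rewrite -inL_swapvals_setU1 // -inR_swapvals_setU1 // IH //; first last.
- move=> q ql; rewrite !inE negb_or ldis' // andbT.
  by apply: contraNneq pl => <-.
- by rewrite subUset sub1set pS.
rewrite mulr_sumr; apply: eq_bigr => T Tl.
have pT : p \notin T by apply: contra pl => /(subsetP Tl); rewrite inE.
by rewrite cardsU1 pT exprS mulrA setUCA setUA.
Qed.

Definition sorted_SigmaPlus := sort (relpre (pdist f) leq) (enum (SigmaPlus f)).

Lemma rhs_cup_sum :
  rhs f = cup_sum m n (map (pair_values f) sorted_SigmaPlus) (inL f) (inR f).
Proof.
apply/funext => g; have := @cup_sum_subsets sorted_SigmaPlus set0 g.
rewrite swapvals_set0 => ->.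
- have -> : [set p in sorted_SigmaPlus] = SigmaPlus f.
    by apply/setP => p; rewrite inE mem_sort mem_enum.
  by apply: eq_bigr => T _; rewrite setU0.
- by rewrite sort_uniq enum_uniq.
- exact: sub0set.
- by move=> p; rewrite mem_sort mem_enum.
by move=> p _; rewrite inE.
Qed.

Lemma noncrossing_SigmaPlus :
  noncrossing (map (pair_values f) sorted_SigmaPlus)
    (only (inL f) (inR f)) (only (inR f) (inL f)).
Proof.
apply: (@noncrossing_suffix _ _ f df [::]) => [p||].
- by rewrite mem_sort mem_enum.
- by rewrite sort_uniq enum_uniq.
by apply: sort_sorted => p q; apply: leq_total.
Qed.

Lemma rhs_triangular :
  rhs f f = 1 /\
  forall g, g != f -> rhs f g != 0 -> bruhat_lt g f /\ in_qZq (rhs f g).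
Proof.
split.
  rewrite /rhs (bigD1 set0) ?sub0set //= big1 => [|S /andP[SS S0]].
    by rewrite fSigma_set0 cards0 expr0 mul1r /Kmon eqxx addr0.
  rewrite /Kmon; case: eqVneq => [e|_]; last by rewrite mulr0.
  by have := fSigma_lt SS S0; rewrite -e => /bruhat_irr.
move=> g gf.
have S_neq0 (S : {set ppair m n}) : g = fSigma f S -> S != set0.
  by move=> gS; apply: contraNneq gf => S0; rewrite gS S0 fSigma_set0.
move=> rg; split.
  have [/existsP[S /andP[SS /eqP eS]]|/existsPn no] :=
      boolP [exists S : {set ppair m n}, (S \subset SigmaPlus f) && (g == fSigma f S)].
    by rewrite eS; apply: fSigma_lt (S_neq0 S eS).
  case/eqP: rg; rewrite /rhs big1 // => S SS.
  by have := no S; rewrite SS /Kmon /= => /negbTE ->; rewrite mulr0.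
(* Several [S] contributing to the same [g] are covered by closure under addition; each contributing
   [S] is nonempty, which supplies the factor q. *)
apply: big_ind => [|x y|S SS]; [exact: in_qZq0 | exact: in_qZqD | ].
rewrite /Kmon; case: eqVneq => [/S_neq0|_]; last by rewrite mulr0; apply: in_qZq0.
rewrite -card_gt0; case: #|S| => // k _; exists 'X^k.
by rewrite mulr1 exprS map_polyXn tofracXn.
Qed.

Lemma inE_rhs : Defs.inE (rhs f).
Proof. by rewrite rhs_cup_sum; apply: inE_cup_sum. Qed.

Lemma bar_rhs (psi : Fock m n -> Fock m n) : is_bar_involution psi ->
  psi (rhs f) = rhs f.
Proof.
by move=> bar_psi; rewrite rhs_cup_sum; apply: bar_cup_sum noncrossing_SigmaPlus.
Qed.

End CupSumSigma.

Theorem theorem4p16 (m n : nat) (f : Zmn m n) (psi : Fock m n -> Fock m n) :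
  dominant f -> is_bar_involution psi ->
  is_canonical psi f (rhs f) /\
  (forall u : Fock m n, is_canonical psi f u -> u = rhs f).
Proof.
move=> df bar_psi.
have rhs_can : is_canonical psi f (rhs f).
  have [rhs1 rhs_lt] := rhs_triangular df.
  by split; [exact: inE_rhs | split; [exact: bar_rhs | split]].
by split=> // u u_can; apply: (canonical_unique bar_psi u_can rhs_can).
Qed.
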